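(* For every integer $d\geq 1$, $\mu(d)=d^2+1$, where $\mu(d)$ is the minimum, over all colourful point configurations $\mathbf{S}_1,\ldots,\mathbf{S}_{d+1}$ in $\mathbb{R}^d$ such that $|\mathbf{S}_i|=d+1$ and $\mathbf{0}\in\operatorname{conv}(\mathbf{S}_i)$ for every $i\in\{1,\ldots,d+1\}$, of the number of colourful simplices $T$ with $\mathbf{0}\in\operatorname{conv}(T)$.
   Context: A colourful point configuration in $\mathbb{R}^d$ is a collection of $d+1$ finite sets of points $\mathbf{S}_1,\ldots,\mathbf{S}_{d+1}\subseteq\mathbb{R}^d$ (the colours). A colourful simplex is a set $T\subseteq\bigcup_{i=1}^{d+1}\mathbf{S}_i$ containing exactly one point of each $\mathbf{S}_i$, i.e. $|T\cap\mathbf{S}_i|=1$ for all $i$.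
   Formalization: The colours S_1,…,S_{d+1} are additionally required to be pairwise disjoint; without this the claim fails, since if all S_i equal one set S with 0 in conv(S) but 0 not in S, the colourful simplices are nonzero singletons and the count is 0. *)

(* Defs.v *)
From mathcomp Require Export all_boot all_order all_algebra.
From mathcomp Require Export finmap.
From mathcomp Require Export boolp classical_sets reals.

Set Implicit Arguments.
Unset Strict Implicit.
Unset Printing Implicit Defensive.

Import Order.TTheory GRing.Theory Num.Theory.
Local Open Scope fset_scope.
Local Open Scope classical_set_scope.
Local Open Scope ring_scope.

(* The convex hull of a finite set of points, as the set of its convex
   combinations. *)
Definition conv (R : realType) (V : lmodType R) (A : {fset V}) : set V :=
  [set v | exists w : V -> R,
     [/\ forall x, x \in A -> 0 <= w x,
         \sum_(x <- A) w x = 1 &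
         v = \sum_(x <- A) w x *: x]].

(* The colours are pairwise disjoint: a point has only one colour. If colours
   could share points, a set meeting each of them in exactly one point would
   no longer amount to a choice of one point per colour: when all the S i are
   equal, such a set is a singleton. *)
Definition colourful_configuration (R : realType) (d : nat)
    (S : 'I_d.+1 -> {fset 'rV[R]_d}) : Prop :=
  forall i j : 'I_d.+1, i != j -> [disjoint S i & S j]%fset.

Definition colourful_simplex (R : realType) (d : nat)
    (S : 'I_d.+1 -> {fset 'rV[R]_d}) (T : {fset 'rV[R]_d}) : Prop :=
  (T `<=` \bigcup_(i <- enum 'I_d.+1) S i)%fset /\
  forall i : 'I_d.+1, #|` (T `&` S i)%fset | = 1%N.

(* A colourful simplex is a subset of the union of the colours, so the sets
   counted are found in its finite powerset. *)
Definition num_simplices_containing0 (R : realType) (d : nat)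
    (S : 'I_d.+1 -> {fset 'rV[R]_d}) : nat :=
  #|` [fset T in fpowerset (\bigcup_(i <- enum 'I_d.+1) S i)%fset
        | `[< colourful_simplex S T /\ conv T 0 >]]%fset |.

Definition attained_counts (R : realType) (d : nat) : set nat :=
  [set n | exists S : 'I_d.+1 -> {fset 'rV[R]_d},
     [/\ colourful_configuration S,
         forall i, #|` S i | = d.+1,
         forall i, conv (S i) 0 &
         n = num_simplices_containing0 S]].

(* The minimum of attained_counts; the default value 0 is taken only if there
   is no admissible configuration. *)
Definition mu (R : realType) (d : nat) : nat :=
  xget 0%N [set m | attained_counts R d m /\
                    forall n, attained_counts R d n -> (m <= n)%N].

(* Main.v *)
Require Import Defs.
From mathcomp Require Import polyrcf.
From mathcomp Require Import topology normedtype derive.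
From mathcomp Require Import ring lra zify.

(* Lower bound. Let [E] be the set of transversals, words with one letter per
   colour, whose convex hull contains [0]. After a perturbation that creates no
   new such transversal, [E] has an even number of elements in every octahedron
   (product of pairs of points). For two points [a], [b] of a colour, the
   symmetric difference of the links [E_a], [E_b] again has this property, and
   this gives by induction on the number of colours [2 + (m - 2) u <= #|E|] for
   nonempty [E], where [m] is the number of points per colour and [u] the number
   of colours whose links violate the parity condition: the inequalities
   [2 + (m - 2) u_ab <= #|E_a| + #|E_b|] are added over all pairs [{a, b}], and
   every colour counted in [u] contributes to at least [m - 1] of the [u_ab].
   With [m] colours this is [m (m - 2) + 2 = d ^ 2 + 1] when all colours count.
   If a colour does not count, its [m] links satisfy the parity condition, are
   nonempty by the colourful Caratheodory theorem, and so have at least [m]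
   elements each.

   Upper bound. One colour is [- (1, ..., 1)] and the points
   [n e_j - (1, ..., 1)], up to scaling; the colour attached to the axis [j] is
   [e_j, - e_j, - 2 e_j, ...]. By signs, only [d ^ 2 + 1] transversals remain. *)

Set Implicit Arguments.
Unset Strict Implicit.
Unset Printing Implicit Defensive.

Import Order.TTheory GRing.Theory Num.Theory.
Import numFieldNormedType.Exports.
Local Open Scope ring_scope.
Local Open Scope classical_set_scope.

(** * Octahedral systems *)

Section OctahedralSystems.
Variable T : finType.
Implicit Types (E F : seq T -> bool) (k j : nat).
Local Open Scope nat_scope.

(* A set [E] of words is only considered on words of a fixed length [k], the
   number of colours; the letter in position [j] is the point of colour [j]. *)
Definition link E (x : T) : seq T -> bool := fun s => E (x :: s).

Definition symdiff E F : seq T -> bool := fun s => E s (+) F s.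

Fixpoint num_edges k E : nat :=
  if k is k'.+1 then \sum_(x : T) num_edges k' (link E x) else E [::].

(** Unfolded, the recursion says that the xor of [E] over the [2 ^ k] words of any product of pairs
    of points is false. *)
Fixpoint octahedral k E : bool :=
  if k is k'.+1 then
    [forall a, forall b, octahedral k' (symdiff (link E a) (link E b))]
  else ~~ E [::].

(* The links of [E] at the points of colour [j] are not octahedral. For
   octahedral [E] this holds at all points of the colour or at none. *)
Fixpoint used k j E : bool :=
  match k, j with
  | 0, _ => false
  | k'.+1, 0 => [exists x, ~~ octahedral k' (link E x)]
  | k'.+1, j'.+1 =>
      [exists a, exists b, used k' j' (symdiff (link E a) (link E b))]
  end.

Definition num_used k E := \sum_(j < k) used k j E.

Lemma symdiffACA E1 E2 F1 F2 :
  symdiff (symdiff E1 E2) (symdiff F1 F2) =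
  symdiff (symdiff E1 F1) (symdiff E2 F2).
Proof. by apply/funext => s; rewrite /symdiff addbACA. Qed.

Lemma symdiffC E F : symdiff E F = symdiff F E.
Proof. by apply/funext => s; rewrite /symdiff addbC. Qed.

Lemma symdiffK E F : symdiff (symdiff E F) F = E.
Proof. by apply/funext => s; rewrite /symdiff addbK. Qed.

Lemma symdiff_chain E F G : symdiff E G = symdiff (symdiff E F) (symdiff F G).
Proof. by apply/funext => s; rewrite /symdiff -addbA addKb. Qed.

Lemma octahedral_symdiff k E F :
  octahedral k E -> octahedral k F -> octahedral k (symdiff E F).
Proof.
elim: k E F => [|k IH] E F /=; first by rewrite /symdiff => /negbTE-> /negbTE->.
move=> /forallP hE /forallP hF; apply/forallP => a; apply/forallP => b.
have := IH _ _ (forallP (hE a) b) (forallP (hF a) b).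
by rewrite symdiffACA.
Qed.

Lemma octahedral_link2 k E a b :
  octahedral k.+1 E -> octahedral k (symdiff (link E a) (link E b)).
Proof. by move=> /forallP/(_ a)/forallP. Qed.

Lemma num_edges_symdiff k E F :
  num_edges k (symdiff E F) <= num_edges k E + num_edges k F.
Proof.
elim: k E F => [|k IH] E F /=; first by rewrite /symdiff; do 2!case: (_ [::]).
by rewrite -big_split leq_sum // => x _; apply: IH.
Qed.

Lemma octahedral_empty k E : num_edges k E = 0 -> octahedral k E.
Proof.
elim: k E => [|k IH] E /=; first by case: (E [::]).
move=> /eqP; rewrite sum_nat_eq0 => /forallP h.
apply/forallP => a; apply/forallP => b; apply: IH; apply/eqP.
rewrite -leqn0 (leq_trans (num_edges_symdiff _ _ _))//.
by rewrite (eqP (h a)) (eqP (h b)).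
Qed.

Lemma used_symdiff k j E F :
  used k j (symdiff E F) -> used k j E || used k j F.
Proof.
elim: k j E F => [//|k IH] [|j] E F /=.
  move=> /existsP[x hx]; rewrite -implyNb; apply/implyP => /existsPn h.
  apply/existsP; exists x; apply: contra hx => hF.
  by apply: octahedral_symdiff => //; move: (h x); rewrite negbK.
move=> /existsP[a /existsP[b]]; rewrite symdiffACA => /IH /orP[] h.
  by apply/orP; left; apply/existsP; exists a; apply/existsP; exists b.
by apply/orP; right; apply/existsP; exists a; apply/existsP; exists b.
Qed.

Lemma used_empty k j E : num_edges k E = 0 -> used k j E = false.
Proof.
elim: k j E => [//|k IH] j E /= /eqP; rewrite sum_nat_eq0 => /forallP h.
case: j => [|j]; apply/negbTE/existsPn => x.
  by rewrite negbK octahedral_empty //; apply/eqP/h.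
apply/existsPn => b; apply/negbT/IH/eqP.
rewrite -leqn0 (leq_trans (num_edges_symdiff _ _ _))//.
by rewrite (eqP (h x)) (eqP (h b)).
Qed.

Lemma num_used_empty k E : num_edges k E = 0 -> num_used k E = 0.
Proof. by move=> h; rewrite /num_used big1 // => j _; rewrite used_empty. Qed.

Lemma used_succ k j E : used k.+1 j.+1 E ->
  exists a b, used k j (symdiff (link E a) (link E b)).
Proof. by move=> /existsP[a /existsP[b h]]; exists a, b. Qed.

Lemma num_usedS k E :
  num_used k.+1 E = used k.+1 0 E + \sum_(j < k) used k.+1 j.+1 E.
Proof. by rewrite /num_used big_ord_recl. Qed.

Lemma octahedral_link k E :
  ~~ used k.+1 0 E -> forall x, octahedral k (link E x).
Proof. by move=> /existsPn h x; move: (h x); rewrite negbK. Qed.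

(** Two links differ by an octahedral set, so one is octahedral exactly when the other is. *)
Lemma nonoctahedral_link k E :
  octahedral k.+1 E -> used k.+1 0 E -> forall x, ~~ octahedral k (link E x).
Proof.
move=> oE /existsP[y hy] x; apply: contra hy => hx.
rewrite -(symdiffK (link E y) (link E x)).
by apply: octahedral_symdiff => //; apply: octahedral_link2.
Qed.

Lemma num_edges_link_gt0 k E :
  octahedral k.+1 E -> used k.+1 0 E -> forall x, 0 < num_edges k (link E x).
Proof.
move=> oE uE x; rewrite lt0n; apply: contraNneq (nonoctahedral_link oE uE x).
exact: octahedral_empty.
Qed.

(* The pairs of links separated by a colour form a cut of the complete graph on
   [T]; a cut has at least [#|T| - 1] edges, each counted twice here. *)
Lemma cut_size k j E : used k.+1 j.+1 E ->
  (#|T|.-1).*2 <= \sum_a \sum_b used k j (symdiff (link E a) (link E b)).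
Proof.
move=> /used_succ[a [b uab]].
set sep := fun x y => used k j (symdiff (link E x) (link E y)) : nat.
have sepC x y : sep x y = sep y x by rewrite /sep symdiffC.
have sepxx x : sep x x = 0.
  rewrite /sep (_ : symdiff _ _ = fun=> false) ?used_empty //; last first.
    by apply/funext => s; rewrite /symdiff addbb.
  by elim: (k) => [//|k' IH] /=; rewrite big1.
(* A colour that separates [a] from [b] separates every [x] from one of the two. *)
have hab x : 1 <= sep a x + sep b x.
  have := used_symdiff (E := symdiff (link E a) (link E x))
                       (F := symdiff (link E x) (link E b)) (k := k) (j := j).
  rewrite -symdiff_chain => /(_ uab); rewrite (symdiffC (link E x)) /sep.
  by do 2!case: used.
have neq_ab : b != a.
  by apply/eqP => eab; move: (sepxx a); rewrite /sep -[in X in symdiff _ X]eab uab.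
rewrite (bigD1 a) //= [X in _ + X](bigD1 b) //= addnA -big_split /=.
(* The rows of [a] and [b] together contribute [#|T|], and each of the other [#|T| - 2] rows at
   least one. *)
have h1 : #|T| <= \sum_i (sep a i + sep b i).
  by rewrite -sum1_card leq_sum.
have h2 : #|T| - 2 <= \sum_(i | (i != a) && (i != b)) \sum_j sep i j.
  have -> : #|T| - 2 = \sum_(i | (i != a) && (i != b)) 1.
    rewrite sum1_card; have := cardC (pred2 a b); rewrite card2 eq_sym neq_ab.
    have -> : #|predC (pred2 a b)| = #|[pred i | (i != a) && (i != b)]|.
      by apply: eq_card => i; rewrite !inE negb_or.
    by move=> <-; rewrite addKn.
  apply: leq_sum => i /andP[ia ib].
  apply: (leq_trans (hab i)); rewrite !(sepC _ i).
  by rewrite (bigD1 a) //= leq_add2l (bigD1 b) //= leq_addr.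
apply: leq_trans (leq_add h1 h2); rewrite -addnn.
by case: #|T| => [|[|m]] //; rewrite subn2 /=; lia.
Qed.

Lemma num_edges_lower k E : 1 < #|T| -> octahedral k E -> 0 < num_edges k E ->
  2 + (#|T| - 2) * num_used k E <= num_edges k E.
Proof.
move=> T_gt1; elim: k E => [|k IH] E oE; first by move: oE => /= /negbTE->.
move=> E_gt0; rewrite num_usedS.
set U := \sum_(j < k) _.
case: (boolP (used k.+1 0 E)) => u0 /=; last first.
  (* All links are octahedral, so induction applies to the nonempty ones. Each remaining used colour
     is used by some link, and some link is nonempty, which supplies the summand 2. *)
  have step x : (#|T| - 2) * num_used k (link E x) +
      2 * (0 < num_edges k (link E x)) <= num_edges k (link E x).
    have [e0|e0] := posnP (num_edges k (link E x)).
      by rewrite num_used_empty ?muln0.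
    by rewrite addnC muln1 IH // octahedral_link.
  have : \sum_x ((#|T| - 2) * num_used k (link E x) +
      2 * (0 < num_edges k (link E x))) <= num_edges k.+1 E.
    by apply: leq_sum => x _.
  apply: leq_trans.
  rewrite big_split /= -!big_distrr /= addnC leq_add ?leq_mul //; last first.
    rewrite (_ : 2 = 2 * 1)// leq_mul2l /=.
    move: E_gt0 => /=; rewrite !lt0n; apply: contraNneq => /eqP.
    rewrite sum_nat_eq0 => /forallP h; apply/eqP; rewrite big1 // => x _.
    by move: (h x); rewrite eqb0 -leqNgt leqn0 => /eqP.
  rewrite add0n /U exchange_big; apply: leq_sum => j _.
  have [/used_succ[a [b]]|//] := boolP (used k.+1 j.+1 E).
  move=> /used_symdiff /orP[] h.
    by rewrite (bigD1 a) //= h.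
  by rewrite (bigD1 b) //= h.
have d_gt0 := num_edges_link_gt0 oE u0.
pose d x := num_edges k (link E x).
pose u a b := num_used k (symdiff (link E a) (link E b)).
(* If the two links coincide, [u a b] vanishes and the 2 comes from both being nonempty. *)
have pair a b : 2 + (#|T| - 2) * u a b <= d a + d b.
  have [e0|e0] := posnP (num_edges k (symdiff (link E a) (link E b))).
    by rewrite /u num_used_empty // muln0 addn0; apply: leq_add (d_gt0 a) (d_gt0 b).
  by rewrite (leq_trans (IH _ _ e0)) ?num_edges_symdiff ?octahedral_link2.
have cuts : U * (#|T|.-1).*2 <= \sum_a \sum_b u a b.
  rewrite /U big_distrl /u /num_used.
  under [X in _ <= X]eq_bigr do rewrite exchange_big.
  rewrite exchange_big; apply: leq_sum => j _.
  have [/cut_size h|_] := boolP (used k.+1 j.+1 E); last by [].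
  by apply: leq_trans h; rewrite leq_eqVlt; apply/orP; left; apply/eqP/mul1n.
have u_diag a : u a a = 0.
  rewrite /u num_used_empty // (_ : symdiff _ _ = fun=> false); last first.
    by apply/funext => s; rewrite /symdiff addbb.
  by elim: (k) => [//|k' IH'] /=; rewrite big1.
pose D := \sum_x d x.
have key : \sum_a \sum_(b | b != a) (2 + (#|T| - 2) * u a b) <=
           \sum_a \sum_(b | b != a) (d a + d b).
  by apply: leq_sum => a _; apply: leq_sum => b _.
have cardN (a : T) : \sum_(b | b != a) 1 = #|T|.-1.
  by rewrite sum1_card (cardC1 a).
have lhs : \sum_a \sum_(b | b != a) (2 + (#|T| - 2) * u a b) =
    #|T| * #|T|.-1 * 2 + (#|T| - 2) * \sum_a \sum_b u a b.
  rewrite (eq_bigr (fun a => #|T|.-1 * 2 + (#|T| - 2) * \sum_b u a b)).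
    by rewrite big_split /= sum_nat_const mulnA big_distrr.
  move=> a _; rewrite [\sum_b u a b](bigD1 a) //= u_diag add0n.
  by rewrite big_split /= -big_distrr -(cardN a) big_distrl.
have rhs : \sum_a \sum_(b | b != a) (d a + d b) = #|T|.-1 * D * 2.
  have h : \sum_a \sum_b (d a + d b) = #|T| * D * 2.
    under eq_bigr do rewrite big_split /= sum_nat_const.
    rewrite big_split /= sum_nat_const -big_distrr /= /D.
    by rewrite addnn -muln2.
  move: h; under eq_bigr => a _ do rewrite (bigD1 a) //= addnn -muln2.
  rewrite big_split -big_distrl /= -/D; nia.
move: key; rewrite lhs rhs -/(num_edges k.+1 E).
have -> : num_edges k.+1 E = D by [].
set N := \sum_a \sum_b u a b in cuts *; move: (#|T|) T_gt1 cuts => m.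
case: m => [//|[//|m]] _; rewrite /= !subn2 /= => cuts key.
(* Here [m] stands for [#|T| - 2]; [key] and [cuts] combine to the goal multiplied by
   [2 (m + 1)]. *)
have : m * (U * (m.+1).*2) <= m * N by rewrite leq_mul2l cuts orbT.
rewrite -(leq_pmul2l (m := (m.+1).*2)) //; nia.
Qed.

(** If colour [0] is used, each of its [#|T|] links is nonempty; otherwise its links are octahedral,
    and by induction a nonempty one already has enough elements. *)
Lemma num_edges_ge_card k E :
  octahedral k E -> 0 < num_edges k E -> #|T| <= num_edges k E.
Proof.
elim: k E => [|k IH] E oE; first by move: oE => /= /negbTE->.
case: (boolP (used k.+1 0 E)) => [u0 _|u0].
  rewrite -sum1_card /= leq_sum // => x _; exact: num_edges_link_gt0.
rewrite lt0n /= sum_nat_eq0 => /forallPn[x]; rewrite -lt0n => hx.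
rewrite (bigD1 x) //= (leq_trans _ (leq_addr _ _)) // IH //.
exact: octahedral_link.
Qed.

Definition link_at j E (y : T) : seq T -> bool :=
  fun s => E (take j s ++ y :: drop j s).

Lemma link_link_at j E y x : link (link_at j.+1 E y) x = link_at j (link E x) y.
Proof. by []. Qed.

Lemma link_at_symdiff j E F y :
  link_at j (symdiff E F) y = symdiff (link_at j E y) (link_at j F y).
Proof. by []. Qed.

Lemma link_at0 E y : link_at 0 E y = link E y.
Proof. by apply/funext => s; rewrite /link_at take0 drop0. Qed.

Lemma octahedral_link_at k j E y :
  j <= k -> ~~ used k.+1 j E -> octahedral k (link_at j E y).
Proof.
elim: k j E => [|k IH] [|j] E // jk.
- by rewrite link_at0 /= => /existsPn /(_ y); rewrite negbK.
- by rewrite link_at0 => /existsPn /(_ y); rewrite negbK.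
move=> /existsPn h; apply/forallP => a; apply/forallP => b.
rewrite !link_link_at -link_at_symdiff; apply: IH => //.
by move: (h a) => /existsPn /(_ b).
Qed.

Lemma num_edges_link_at k j E : j <= k ->
  num_edges k.+1 E = \sum_y num_edges k (link_at j E y).
Proof.
elim: k j E => [|k IH] [|j] E // jk;
  try by apply: eq_bigr => y _; rewrite link_at0.
rewrite [RHS]exchange_big /=; apply: eq_bigr => x _.
exact: (IH j).
Qed.

Lemma octahedral_system_bound k E :
  1 < #|T| -> octahedral k.+1 E -> 0 < num_edges k.+1 E ->
  (forall j y, j <= k -> 0 < num_edges k (link_at j E y)) ->
  minn (2 + (#|T| - 2) * k.+1) (#|T| * #|T|) <= num_edges k.+1 E.
Proof.
move=> T_gt1 oE E_gt0 nonisolated.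
case: (boolP [forall j : 'I_k.+1, used k.+1 j E]) => [/forallP h|/forallPn[j hj]].
  rewrite geq_min; apply/orP; left.
  have := num_edges_lower T_gt1 oE E_gt0.
  rewrite /num_used (eq_bigr (fun=> 1)) => [|j _]; last by rewrite h.
  by rewrite sum1_card card_ord.
rewrite geq_min; apply/orP; right.
have jk : j <= k by rewrite -ltnS.
rewrite (num_edges_link_at E jk) -sum_nat_const leq_sum // => y _.
by rewrite num_edges_ge_card ?nonisolated // octahedral_link_at.
Qed.

End OctahedralSystems.

(** * Nearest points and colourful Caratheodory *)

Section DotProduct.
Variables (R : realType) (d : nat).
Implicit Types u v : 'rV[R]_d.

Definition dot u v : R := \sum_i u 0 i * v 0 i.

Lemma dotC u v : dot u v = dot v u.
Proof. by apply: eq_bigr => i _; rewrite mulrC. Qed.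

Lemma dotDr u v w : dot u (v + w) = dot u v + dot u w.
Proof. by rewrite -big_split; apply: eq_bigr => i _; rewrite mxE mulrDr. Qed.

Lemma dotZr u a v : dot u (a *: v) = a * dot u v.
Proof. by rewrite big_distrr; apply: eq_bigr => i _; rewrite mxE mulrCA. Qed.

Lemma dot0r u : dot u 0 = 0.
Proof. by rewrite -(scale0r 0) dotZr mul0r. Qed.

Lemma dotBr u v w : dot u (v - w) = dot u v - dot u w.
Proof. by rewrite -scaleN1r dotDr dotZr mulN1r. Qed.

Lemma dot_sumr (I : finType) u (F : I -> 'rV[R]_d) :
  dot u (\sum_i F i) = \sum_i dot u (F i).
Proof. by apply: big_morph => [v w|]; rewrite ?dotDr ?dot0r. Qed.

Lemma dot_combr (I : finType) u (w : I -> R) (v : I -> 'rV[R]_d) :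
  dot u (\sum_i w i *: v i) = \sum_i w i * dot u (v i).
Proof. by rewrite dot_sumr; apply: eq_bigr => i _; rewrite dotZr. Qed.

Lemma dot_ge0 u : 0 <= dot u u.
Proof. by apply: sumr_ge0 => i _; rewrite -expr2 sqr_ge0. Qed.

Lemma dot_eq0 u : (dot u u == 0) = (u == 0).
Proof.
apply/eqP/eqP => [/eqP|->]; last exact: dot0r.
rewrite psumr_eq0 => [/allP h|i _]; last by rewrite -expr2 sqr_ge0.
apply/rowP => i; rewrite mxE; apply/eqP.
by move: (h i (mem_index_enum i)); rewrite mulf_eq0 orbb.
Qed.

Lemma dot_gt0 u : u != 0 -> 0 < dot u u.
Proof. by move=> u0; rewrite lt_neqAle eq_sym dot_eq0 u0 dot_ge0. Qed.

Lemma dot_sqrDZ u t v :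
  dot (u + t *: v) (u + t *: v) = dot u u + (2 * t * dot u v + t ^+ 2 * dot v v).
Proof.
rewrite dotDr dotZr 2!(dotC (u + _)) !dotDr !dotZr (dotC v u); ring.
Qed.

(** First-order condition at [t = 0], where the derivative is [2 * dot u v]. *)
Lemma dot_minimal u v :
  (forall t, 0 < t -> t <= 1 -> dot u u <= dot (u + t *: v) (u + t *: v)) ->
  0 <= dot u v.
Proof.
move=> h; rewrite leNgt; apply/negP => c_lt0.
set c := dot u v in c_lt0; set e := dot v v; have e_ge0 : 0 <= e := dot_ge0 v.
have den : 0 < e - c by lra.
(* This [t] satisfies [t * e <= - c], so the change [t * (2 * c + t * e)] would be negative. *)
pose t := - c / (e - c).
have t_gt0 : 0 < t by rewrite divr_gt0 // oppr_gt0.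
have t_le1 : t <= 1 by rewrite ler_pdivrMr // mul1r; lra.
have := h t t_gt0 t_le1; rewrite dot_sqrDZ -/c -/e lerDl => hh.
have te : t * e <= - c.
  by rewrite /t mulrAC ler_pdivrMr // ler_wpM2l //; lra.
have : 0 <= t * (2 * c + t * e) by move: hh; congr (0 <= _); ring.
by rewrite pmulr_rge0 //; lra.
Qed.

End DotProduct.

Section ConvexRelations.
Variable R : realType.

Definition weights (I : finType) (w : I -> R) :=
  (forall i, 0 <= w i) /\ \sum_i w i = 1.

(** The origin lies in the convex hull of the family; unlike the finite sets in [conv], a family may
    repeat points. *)
Definition hit (d : nat) (I : finType) (v : I -> 'rV[R]_d) : Prop :=
  exists2 w, weights w & \sum_i w i *: v i = 0.

Lemma hit_pos (d : nat) (I : finType) (v : I -> 'rV[R]_d) (w : I -> R) :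
  (forall i, 0 <= w i) -> (exists i, 0 < w i) -> \sum_i w i *: v i = 0 ->
  hit v.
Proof.
move=> w_ge0 [i0 wi0] wv; pose s := \sum_i w i.
have s_gt0 : 0 < s.
  rewrite /s (bigD1 i0) //= ltr_wpDr ?wi0 // sumr_ge0 //.
exists (fun i => s^-1 * w i); first split.
- by move=> i; rewrite mulr_ge0 // invr_ge0 ltW.
- by rewrite -big_distrr /= mulVf // gt_eqF.
by under eq_bigr do rewrite -scalerA; rewrite -scaler_sumr wv scaler0.
Qed.

Lemma weights_pos (I : finType) (w : I -> R) : weights w -> exists i, 0 < w i.
Proof.
move=> [w_ge0 w1]; apply/not_existsP => h.
suff : \sum_i w i <= 0 by rewrite w1 ler10.
by apply: sumr_le0 => i _; rewrite leNgt; apply/negP/h.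
Qed.

Lemma weights_step (I : finType) (w : I -> R) t k :
  weights w -> 0 < t -> t <= 1 ->
  weights (fun i => (1 - t) * w i + t * (i == k)%:R).
Proof.
move=> [w_ge0 w1] t0 t1; split=> [i|].
  by rewrite addr_ge0 ?mulr_ge0 ?subr_ge0 ?ler0n // ltW.
rewrite big_split /= -!big_distrr /= w1 mulr1.
rewrite (bigD1 k) //= eqxx big1 => [|i /negbTE->//].
by rewrite addr0 mulr1 subrK.
Qed.

Lemma comb_step (d : nat) (I : finType) (v : I -> 'rV[R]_d) (w : I -> R) t k :
  \sum_i ((1 - t) * w i + t * (i == k)%:R) *: v i =
  \sum_i w i *: v i + t *: (v k - \sum_i w i *: v i).
Proof.
under eq_bigr do rewrite scalerDl -!scalerA.
rewrite big_split /= -!scaler_sumr [X in _ + t *: X](bigD1 k) //= eqxx.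
rewrite [X in _ *: _ + t *: (_ + X)]big1 => [|i /negbTE->]; last by rewrite scale0r.
by rewrite scale1r addr0 scalerBl scale1r scalerBr -!addrA [- _ + _]addrC.
Qed.

(** The squared norm is continuous in the weights, which range over a compact simplex: the unit cube
    [B] cut by the closed condition [C]. *)
Lemma nearest_point (d n : nat) (v : 'I_n.+1 -> 'rV[R]_d) :
  exists2 w, weights w & forall w', weights w' ->
    dot (\sum_i w i *: v i) (\sum_i w i *: v i) <=
    dot (\sum_i w' i *: v i) (\sum_i w' i *: v i).
Proof.
pose f (w : 'rV[R]_n.+1) :=
  dot (\sum_i w 0 i *: v i) (\sum_i w 0 i *: v i).
pose B := [set w : 'rV[R]_n.+1 | forall i, `[0, 1]%classic (w ord0 i)].
(* The factor 1 gives the sum the form treated by [cont_sum]. *)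
pose C := [set w : 'rV[R]_n.+1 | \sum_i w 0 i * 1 = 1].
have cont_sum (a : 'I_n.+1 -> R) :
    continuous (fun w : 'rV[R]_n.+1 => \sum_i w 0 i * a i).
  apply: continuous_big => [|i _ w]; first exact: add_continuous.
  have ci : continuous (fun w : 'rV[R]_n.+1 => w 0 i).
    exact: coord_continuous.
  by apply: continuousM; [exact: ci|exact: cst_continuous].
have cB : compact B.
  exact: (@rV_compact R n.+1 (fun=> `[0:R, 1]%classic)
            (fun=> @segment_compact R 0 1)).
have cC : closed C.
  exact: (proj1 (continuous_closedP _) (cont_sum (fun=> 1)) _ (@closed_eq R 1)).
have [|||w wBC wmin] := @EVT_min_rV R n.+1 f (B `&` C).
- exists (delta_mx 0 0); split=> [i|].
    by rewrite /= mxE in_itv /=; case: (_ == _); rewrite /= ?lexx ?ler01.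
  rewrite /C /= (bigD1 0) //= big1 ?mxE ?eqxx ?addr0 ?mulr1 // => i /negbTE i0.
  by rewrite mxE i0 mul0r.
- exact: compact_closedI.
- apply: continuous_subspaceT.
  apply: continuous_big => [|j _ w]; first exact: add_continuous.
  have cj : continuous (fun w : 'rV[R]_n.+1 => (\sum_i w 0 i *: v i) 0 j).
    have -> : (fun w : 'rV[R]_n.+1 => (\sum_i w 0 i *: v i) 0 j) =
              (fun w => \sum_i w 0 i * v i 0 j).
      by apply/funext => u; rewrite summxE; apply: eq_bigr => i _; rewrite mxE.
    exact: cont_sum.
  by apply: continuousM; exact: cj.
move: wBC; rewrite inE => -[wB wC].
exists (fun i => w 0 i); first split => [i|].
- by have := wB i; rewrite /= in_itv /= => /andP[].
- by rewrite -[RHS]wC; apply: eq_bigr => i _; rewrite mulr1.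
move=> w' [w'0 w'1].
have e : \sum_i (\row_j w' j) 0 i *: v i = \sum_i w' i *: v i.
  by apply: eq_bigr => i _; rewrite mxE.
have := wmin (\row_i w' i); rewrite /f e; apply.
rewrite inE; split => [i|]; last first.
  by rewrite /C /=; under eq_bigr do rewrite mxE mulr1.
rewrite /= mxE in_itv /= w'0 /= -w'1 (bigD1 i) //= lerDl sumr_ge0 //.
Qed.

(** The point of the hull nearest to the origin serves as [c]: moving from it towards a vertex
    cannot decrease the norm. *)
Lemma gordan (d n : nat) (v : 'I_n.+1 -> 'rV[R]_d) :
  ~ hit v -> exists c, forall i, 0 < dot c (v i).
Proof.
move=> nhit; have [w ww wmin] := nearest_point v.
set z := \sum_i w i *: v i in wmin; exists z => i.
have z0 : z != 0 by apply/eqP => z0; apply: nhit; exists w.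
suff : 0 <= dot z (v i - z) by have := dot_gt0 z0; rewrite dotBr; lra.
apply: dot_minimal => t t0 t1.
by rewrite -comb_step; apply/wmin/weights_step.
Qed.

Lemma linear_dependence (d : nat) (I : finType) (v : I -> 'rV[R]_d) :
  (d < #|I|)%N -> exists2 a : I -> R, \sum_i a i *: v i = 0 & exists i, a i != 0.
Proof.
move=> dI; pose A := \matrix_(i < #|I|) v (enum_val i).
have : kermx A != 0.
  by rewrite -mxrank_eq0 mxrank_ker -lt0n subn_gt0 (leq_ltn_trans (rank_leq_col _)).
move=> /rowV0Pn[u /sub_kermxP uA u0].
exists (fun i => u 0 (enum_rank i)).
  rewrite (reindex_onto enum_val enum_rank) /= => [|i _]; last exact: enum_rankK.
  rewrite -[RHS]uA; apply/rowP => j; rewrite summxE [RHS]mxE.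
  apply: eq_big => i; first by rewrite enum_valK eqxx.
  by rewrite !mxE enum_valK.
have [i ui] : exists i, u 0 i != 0.
  apply/existsP; apply: contraNT u0 => /existsPn h; apply/eqP/rowP => i.
  by rewrite mxE; apply/eqP; rewrite -[_ == _]negbK.
by exists (enum_val i); rewrite enum_valK.
Qed.

End ConvexRelations.

Section ColourfulCaratheodory.
Variable R : realType.

Lemma weights_le1 (I : finType) (w : I -> R) i : weights w -> w i <= 1.
Proof.
by move=> [w0 <-]; rewrite (bigD1 i) //= lerDl sumr_ge0.
Qed.

Lemma nonneg_sum_eq0 (I : finType) (a : I -> R) i :
  (forall i, 0 <= a i) -> \sum_i a i = 0 -> a i = 0.
Proof.
move=> a0 /eqP; rewrite psumr_eq0 // => /allP h.
by apply/eqP/h/mem_index_enum.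
Qed.

(** If all weights are positive, all vertices lie on the hyperplane [dot z x = dot z z]. Pairing a
    linear dependence with [z] then shows that its coefficients sum to 0, so it can be added to the
    weights until one vanishes. *)
Lemma nearest_support (d n : nat) (v : 'I_n.+1 -> 'rV[R]_d) (w : 'I_n.+1 -> R) :
  (d <= n)%N -> weights w -> \sum_i w i *: v i != 0 ->
  (forall i, dot (\sum_i w i *: v i) (\sum_i w i *: v i) <=
             dot (\sum_i w i *: v i) (v i)) ->
  exists w' k, [/\ weights w', w' k = 0 &
                   \sum_i w' i *: v i = \sum_i w i *: v i].
Proof.
set z := \sum_i w i *: v i => dn ww z0 zmin.
have [[k wk]|nz] := pselect (exists k, w k = 0); first by exists w, k.
have w_gt0 k : 0 < w k.
  rewrite lt_neqAle (proj1 ww) andbT eq_sym; apply/eqP => wk.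
  by apply: nz; exists k.
have zv i : dot z (v i) = dot z z.
  apply/eqP; rewrite -subr_eq0; apply/eqP.
  have : w i * (dot z (v i) - dot z z) = 0.
    apply: (@nonneg_sum_eq0 _ (fun i => w i * (dot z (v i) - dot z z))).
      by move=> j; rewrite mulr_ge0 ?subr_ge0 // ltW.
    under eq_bigr do rewrite mulrBr.
    by rewrite sumrB -dot_combr -big_distrl /= (proj2 ww) mul1r subrr.
  by move/eqP; rewrite mulf_eq0 gt_eqF //= => /eqP.
have [|a av [j aj]] := @linear_dependence R d 'I_n.+1 v; first by rewrite card_ord.
have suma : \sum_i a i = 0.
  have : \sum_i a i * dot z (v i) = 0 by rewrite -dot_combr av dot0r.
  under eq_bigr do rewrite zv.
  by rewrite -big_distrl /= => /eqP; rewrite mulf_eq0 dot_eq0 (negbTE z0) orbF => /eqP.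
(* At the maximum [r k], the inverse of [r k] is the largest step that keeps all weights
   nonnegative. *)
pose r i := - a i / w i.
have [k _ kmax] := @Order.TotalTheory.arg_maxP _ _ _ ord0 xpredT r erefl.
have rk_gt0 : 0 < r k.
  rewrite ltNge; apply/negP => rk.
  have a0 i : 0 <= a i.
    have := le_trans (kmax i erefl) rk.
    by rewrite /r pmulr_lle0 ?invr_gt0 // oppr_le0.
  by move: aj; rewrite (nonneg_sum_eq0 j a0 suma) eqxx.
have aE i : a i = - (r i * w i) by rewrite /r divfK ?opprK // gt_eqF.
exists (fun i => w i + (r k)^-1 * a i), k; split.
- split=> [i|]; last by rewrite big_split /= -big_distrr /= suma mulr0 addr0 (proj2 ww).
  have -> : w i + (r k)^-1 * a i = w i * (r k)^-1 * (r k - r i).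
    by rewrite aE; field; rewrite gt_eqF.
  apply: mulr_ge0; first by rewrite divr_ge0 // ltW.
  by rewrite subr_ge0; exact: kmax.
- by rewrite aE mulrN mulrA mulVf ?mul1r ?subrr // gt_eqF.
under eq_bigr do rewrite scalerDl -scalerA.
by rewrite big_split /= -scaler_sumr av scaler0 addr0.
Qed.

(* Barany's argument. Moving the other colours far away, by the factor [s],
   prevents the point of the polytope nearest to [0] from leaving unused only
   the vertex [p i0 k0], which may not be exchanged. *)
Lemma colourful_caratheodory (d : nat) (K : finType)
    (p : 'I_d.+2 -> K -> 'rV[R]_d.+1) (i0 : 'I_d.+2) (k0 : K) :
  (forall i, hit (p i)) ->
  exists2 f : 'I_d.+2 -> K, f i0 = k0 & hit (fun i => p i (f i)).
Proof.
move=> hp; apply: contrapT => nh.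
pose q s (f : {ffun 'I_d.+2 -> K}) i := if i == i0 then p i0 k0 else s *: p i (f i).
have nhit (f : {ffun 'I_d.+2 -> K}) (s : R) w : 0 < s -> weights w ->
    \sum_i w i *: q s f i != 0.
  move=> s0 ww; apply/eqP => e; apply: nh.
  exists (fun i => if i == i0 then k0 else f i); first by rewrite eqxx.
  have [j wj] := weights_pos ww.
  apply: (@hit_pos _ _ _ _ (fun i => if i == i0 then w i else w i * s)).
  - by move=> i; case: ifP => _; rewrite ?mulr_ge0 ?(proj1 ww) ?ltW.
  - by exists j; case: ifP => _; rewrite ?mulr_gt0.
  - rewrite -[RHS]e; apply: eq_bigr => i _; rewrite /q.
    by case: eqP => [->//|_]; rewrite scalerA.
pose v (f : {ffun 'I_d.+2 -> K}) j := p (lift i0 j) (f (lift i0 j)).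
have qE (f : {ffun 'I_d.+2 -> K}) s w : w i0 = 0 ->
    \sum_i w i *: q s f i = s *: \sum_j w (lift i0 j) *: v f j.
  move=> wi0; rewrite (bigD1_ord i0) //= wi0 scale0r add0r scaler_sumr.
  apply: eq_bigr => j _.
  by rewrite /q eq_sym (negbTE (neq_lift _ _)) !scalerA mulrC.
(* [D f] bounds below the squared norm on the hull of the points chosen outside colour [i0]; it is
   positive because that hull misses the origin. *)
have /choice[D Dp] : forall f, exists e, 0 < e /\ forall w, weights w ->
      e <= dot (\sum_j w j *: v f j) (\sum_j w j *: v f j).
  move=> f.
  have [w ww wmin] := nearest_point (v f).
  exists (dot (\sum_j w j *: v f j) (\sum_j w j *: v f j)); split=> //.
  apply: dot_gt0.
  pose w' i := if unlift i0 i is Some j then w j else 0.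
  have := @nhit f 1 w' ltr01; rewrite qE ?scale1r; last by rewrite /w' unlift_none.
  have -> : \sum_j w' (lift i0 j) *: v f j = \sum_j w j *: v f j.
    by apply: eq_bigr => j _; rewrite /w' liftK.
  apply; split=> [i|].
    by rewrite /w'; case: unliftP => // j _; exact: (proj1 ww).
  rewrite (bigD1_ord i0) //= {1}/w' unlift_none add0r -(proj2 ww).
  by apply: eq_bigr => j _; rewrite /w' liftK.
pose x := p i0 k0.
pose B f := \sum_j `|dot x (v f j)|.
have B_ge0 f : 0 <= B f by apply: sumr_ge0.
pose s := 1 + \sum_(f : {ffun 'I_d.+2 -> K}) B f / D f.
have sB f : B f < s * D f.
  have [D0 _] := Dp f; rewrite -ltr_pdivrMr // /s (bigD1 f) //= addrCA.
  rewrite ltrDl ltr_wpDr ?ltr01 // sumr_ge0 // => g _.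
  by rewrite divr_ge0 // ltW // (proj1 (Dp g)).
have s_gt0 : 0 < s.
  rewrite /s ltr_wpDr ?ltr01 // sumr_ge0 // => g _.
  by rewrite divr_ge0 // ltW // (proj1 (Dp g)).
(* Dividing by [s] would give [s * dot z z <= dot z x], but the right side is at most [B f], which
   is below [s * D f]. *)
have bad f w : weights w -> w i0 = 0 ->
    dot (\sum_i w i *: q s f i) (\sum_i w i *: q s f i) <=
    dot (\sum_i w i *: q s f i) x -> False.
  move=> ww wi0; rewrite qE // dotZr ![dot (s *: _) _]dotC !dotZr.
  rewrite ler_pM2l //; set z := \sum_j _.
  have ww' : weights (fun j => w (lift i0 j)).
    split=> [j|]; first exact: (proj1 ww).
    by have := proj2 ww; rewrite (bigD1_ord i0) //= wi0 add0r.
  have := proj2 (Dp f) _ ww'; rewrite -/z => Dz.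
  have zB : dot x z <= B f.
    rewrite /z dot_combr; apply: ler_sum => j _.
    apply: le_trans (ler_norm _) _; rewrite normrM ler_piMl //.
    by rewrite ger0_norm ?(proj1 ww) ?(weights_le1 _ ww).
  have : s * D f <= s * dot z z by rewrite ler_pM2l.
  have := sB f; lra.
have /choice[W Wp] : forall f, exists W, weights W /\ forall w', weights w' ->
    dot (\sum_i W i *: q s f i) (\sum_i W i *: q s f i) <=
    dot (\sum_i w' i *: q s f i) (\sum_i w' i *: q s f i).
  move=> f.
  by have [w ww wmin] := nearest_point (q s f); exists w.
pose Z f := \sum_i W f i *: q s f i.
have [f _ fmin] := @Order.TotalTheory.arg_minP _ _ _ [ffun=> k0] xpredT
  (fun f => dot (Z f) (Z f)) erefl.
have z0 : Z f != 0 by apply: nhit => //; exact: (proj1 (Wp f)).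
have zmin i : dot (Z f) (Z f) <= dot (Z f) (q s f i).
  rewrite -subr_ge0 -dotBr; apply: dot_minimal => t t0 t1.
  by rewrite -comb_step; apply/(proj2 (Wp f))/weights_step/t1/t0/(proj1 (Wp f)).
have [w [k [ww wk wZ]]] := nearest_support (leqnn _) (proj1 (Wp f)) z0 zmin.
have [kE|ki0] := eqVneq k i0.
  apply: (bad f w) => //; first by rewrite -kE.
  by rewrite wZ; have := zmin i0; rewrite /q eqxx.
have [wp wwp wp0] := hp k.
have [l zl] : exists l, dot (Z f) (p k l) <= 0.
  apply/not_existsP => h.
  have [l wl] := weights_pos wwp.
  have /eqP : wp l * dot (Z f) (p k l) = 0.
    apply: (nonneg_sum_eq0 (a := fun l => wp l * dot (Z f) (p k l))).
      move=> m; rewrite mulr_ge0 ?(proj1 wwp) //.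
      by rewrite ltW // ltNge; apply/negP/h.
    by rewrite -dot_combr wp0 dot0r.
  rewrite mulf_eq0 gt_eqF //= => /eqP e0; apply: (h l); by rewrite e0.
pose g := [ffun i => if i == k then l else f i].
have gz : \sum_i w i *: q s g i = Z f.
  rewrite /Z -wZ; apply: eq_bigr => i _; rewrite /q ffunE.
  by case: (eqVneq i k) => [->|//]; rewrite wk !scale0r.
have : 0 <= dot (Z f) (q s g k - Z f).
  apply: dot_minimal => t t0 t1.
  apply: le_trans (fmin g erefl) _.
  have := comb_step (q s g) w t k; rewrite gz => <-.
  by apply: (proj2 (Wp g)); apply: weights_step.
rewrite dotBr /q ffunE eqxx (negbTE ki0) dotZr.
have := dot_gt0 z0; have : s * dot (Z f) (p k l) <= 0 by rewrite pmulr_rle0.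
by lra.
Qed.

End ColourfulCaratheodory.

(** * Parity of the number of transversals containing the origin *)

Section OctahedralExamples.
Variable T : finType.
Implicit Types (E F : seq T -> bool) (k j : nat).

Lemma eq_octahedral k E F :
  (forall s, size s = k -> E s = F s) -> octahedral k E = octahedral k F.
Proof.
elim: k E F => [|k IH] E F h /=; first by rewrite h.
apply: eq_forallb => a; apply: eq_forallb => b; apply: IH => s sk.
by rewrite /symdiff /link !h //= sk.
Qed.

Lemma octahedral_succ k E :
  (forall a b, octahedral k (symdiff (link E a) (link E b))) ->
  octahedral k.+1 E.
Proof. by move=> h; apply/forallP => a; apply/forallP => b; exact: h. Qed.

Lemma octahedral_false k : octahedral k (fun _ : seq T => false).
Proof.
elim: k => [//|k IH]; apply: octahedral_succ => a b.
by rewrite (@eq_octahedral _ _ (fun=> false)).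
Qed.

Lemma octahedral_big k (I : Type) (r : seq I) (H : I -> seq T -> bool) :
  (forall i, octahedral k (H i)) ->
  octahedral k (fun s => \big[addb/false]_(i <- r) H i s).
Proof.
move=> oH; elim: r => [|i r IH].
  rewrite (@eq_octahedral _ _ (fun=> false)) ?octahedral_false // => s _.
  by rewrite big_nil.
rewrite (@eq_octahedral _ _
  (symdiff (H i) (fun s => \big[addb/false]_(i <- r) H i s))).
  exact: octahedral_symdiff.
by move=> s _; rewrite big_cons.
Qed.

(** All links at points of colour [j] coincide, so their symmetric differences are empty. *)
Lemma octahedral_indep k j (x0 : T) E : (j < k)%N ->
  (forall s t, size s = k -> size t = k ->
     (forall i, (i < k)%N -> i != j -> nth x0 s i = nth x0 t i) -> E s = E t) ->
  octahedral k E.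
Proof.
elim: k j E => [//|k IH] j E jk h; apply: octahedral_succ => a b.
case: j jk h => [_|j jk] h.
  rewrite (@eq_octahedral _ _ (fun=> false)) ?octahedral_false // => s sk.
  rewrite /symdiff /link (h (a :: s) (b :: s)) ?addbb //= ?sk // => -[|i] //.
apply: (IH j) => // s t sk tk hst.
by rewrite /symdiff /link; congr (_ (+) _); apply: h => //=;
  rewrite ?sk ?tk // => -[|i] //= ik ij; apply: hst.
Qed.

End OctahedralExamples.

Section Parity.
Variable R : realType.

Definition hit_avoiding (d : nat) (I : finType) (v : I -> 'rV[R]_d) (k : I) :=
  exists a : I -> R, [/\ forall i, 0 <= a i, exists i, 0 < a i, a k = 0 &
                         \sum_i a i *: v i = 0].

(** The vectors left after removing any two are linearly independent; for [d + 2] vectors they form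
    a basis. *)
Definition general_position (d : nat) (I : finType) (v : I -> 'rV[R]_d) :=
  forall (k l : I) (a : I -> R), k != l -> a k = 0 -> a l = 0 ->
    \sum_i a i *: v i = 0 -> forall i, a i = 0.

(* The relations between the vectors form a plane. Relative to a positive
   relation [a] vanishing only at [k0] and a relation [b], a nonnegative
   relation can vanish at another [k] only if [b k / a k] is minimal. *)
Lemma hit_avoiding_pair (d : nat) (I : finType) (v : I -> 'rV[R]_d) k0 :
  #|I| = d.+2 -> general_position v -> hit_avoiding v k0 ->
  exists2 k1, k1 != k0 & forall k, hit_avoiding v k <-> k = k0 \/ k = k1.
Proof.
move=> cI gv [a [a_ge0 [ia aia] ak0 av]].
have a_gt0 i : i != k0 -> 0 < a i.
  move=> ik; rewrite lt_neqAle a_ge0 andbT eq_sym; apply/eqP => ai.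
  by move: aia; rewrite (gv _ _ _ ik ai ak0 av) ltxx.
have ia0 : ia != k0 by apply: contraTneq aia => ->; rewrite ak0 ltxx.
have [b bv bk0] : exists2 b : I -> R, \sum_i b i *: v i = 0 & b k0 = 1.
  (* The extra coordinate forces the new relation to vanish at [ia]; by general position it then
     does not vanish at [k0]. *)
  pose v' i : 'rV[R]_(d + 1) := row_mx (v i) (const_mx (i == ia)%:R).
  have [|b bv' [j bj]] := @linear_dependence R (d + 1) I v'.
    by rewrite cI addn1.
  have bv : \sum_i b i *: v i = 0.
    have := congr1 lsubmx bv'; rewrite linear0 linear_sum /= => h.
    by rewrite -[RHS]h; apply: eq_bigr => i _; rewrite linearZ /= row_mxKl.
  have bia : b ia = 0.
    have := congr1 (fun m => rsubmx m 0 0) bv'.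
    rewrite linear0 linear_sum /= summxE mxE => h.
    rewrite -[RHS]h (bigD1 ia) //= big1 => [|i /negbTE ii].
      by rewrite linearZ /= row_mxKr !mxE eqxx mulr1 addr0.
    by rewrite linearZ /= row_mxKr !mxE ii mulr0.
  have bk : b k0 != 0.
    by apply: contraNneq bj => bk; apply/eqP/(gv _ _ _ ia0 bia bk bv).
  exists (fun i => (b k0)^-1 * b i); last by rewrite mulVf.
  by under eq_bigr do rewrite -scalerA; rewrite -scaler_sumr bv scaler0.
(* The relation [c k] is the combination of [a] and [b] that vanishes at [k]. *)
pose c k i := a k * b i - b k * a i.
have cv k : \sum_i c k i *: v i = 0.
  under eq_bigr do rewrite scalerBl -!scalerA.
  by rewrite sumrB -!scaler_sumr av bv !scaler0 subrr.
have ck0 k : c k k0 = a k by rewrite /c ak0 bk0; ring.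
have ckk k : c k k = 0 by rewrite /c mulrC subrr.
pose r i := b i / a i.
have cE k i : k != k0 -> i != k0 -> c k i = a k * a i * (r i - r k).
  move=> /a_gt0 ak /a_gt0 ai; rewrite /c /r; field.
  by rewrite !gt_eqF.
have [k1 k10 k1min] := @Order.TotalTheory.arg_minP _ _ _ ia (fun i => i != k0) r ia0.
exists k1 => // k; split=> [[e [e_ge0 [ie eie] ek ev]]|[->|->]].
- have [|kk0] := eqVneq k k0; [by left|right].
  apply/eqP/negPn/negP => kk1.
  have e_eq i : a k * e i = e k0 * c k i.
    apply/eqP; rewrite -subr_eq0; apply/eqP.
    apply: (gv k k0 (fun i => a k * e i - e k0 * c k i) kk0).
    + by rewrite ek ckk !mulr0 subrr.
    + by rewrite ck0 mulrC subrr.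
    under eq_bigr do rewrite scalerBl -!scalerA.
    by rewrite sumrB -!scaler_sumr ev cv !scaler0 subrr.
  have ek0 : 0 < e k0.
    rewrite lt_neqAle e_ge0 andbT eq_sym; apply/eqP => e0.
    have := e_eq ie; rewrite e0 mul0r => /eqP.
    by rewrite mulf_eq0 !gt_eqF ?a_gt0.
  have : 0 <= e k0 * c k k1 by rewrite -e_eq mulr_ge0.
  rewrite pmulr_rge0 // cE // pmulr_rge0 ?mulr_gt0 ?a_gt0 // subr_ge0 => h.
  have rE : r k1 = r k by apply/eqP; rewrite eq_le h k1min.
  have ck1 : c k k1 = 0 by rewrite cE // rE subrr mulr0.
  have := gv _ _ _ kk1 (ckk k) ck1 (cv k) k0.
  by rewrite ck0 => /eqP; rewrite gt_eqF ?a_gt0.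
- by exists a; split => //; exists ia.
exists (c k1); split => //.
- move=> i; have [->|ii] := eqVneq i k0; first by rewrite ck0.
  by rewrite cE // mulr_ge0 ?mulr_ge0 // subr_ge0; exact: k1min.
- by exists k0; rewrite ck0 a_gt0.
Qed.

Lemma even_hits (d : nat) (I : finType) (v : I -> 'rV[R]_d) :
  #|I| = d.+2 -> general_position v ->
  \big[addb/false]_k `[< hit_avoiding v k >] = false.
Proof.
move=> cI gv; have [[k0 hk0]|nh] := pselect (exists k0, hit_avoiding v k0).
  have [k1 k10 h] := hit_avoiding_pair cI gv hk0.
  rewrite (bigD1 k0) //= (bigD1 k1) //= !asboolT; last by apply/h; left.
    rewrite big1 // => i /andP[i0 i1]; apply/asboolF => /h[] e;
    by rewrite e eqxx in i0 i1.
  by apply/h; right.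
by rewrite big1 // => i _; apply/asboolF => hi; apply: nh; exists i.
Qed.

(** For [u] on the moment curve, [dot (c i) u] is the value at [x] of the polynomial with
    coefficients [c i]; the Cauchy bound of the product of these polynomials is a root of none. *)
Lemma generic_vector (d : nat) (I : finType) (c : I -> 'rV[R]_d) :
  (forall i, c i != 0) -> exists u, forall i, dot (c i) u != 0.
Proof.
move=> c0; pose P := \prod_i rVpoly (c i).
have P0 : P != 0.
  apply/prodf_neq0 => i _; apply: contraNneq (c0 i) => e.
  by rewrite -(rVpolyK (c i)) e linear0.
pose x := cauchy_bound P.
exists (\row_k x ^+ k) => i.
have -> : dot (c i) (\row_k x ^+ k) = (rVpoly (c i)).[x].
  rewrite /rVpoly horner_poly; apply: eq_bigr => k _.
  by rewrite mxE valK.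
have : P.[x] != 0.
  apply/eqP => /(cauchy_boundP P0); rewrite ltNge => /negP; apply.
  exact: ler_norm.
by rewrite /P horner_prod => /prodf_neq0/(_ i erefl).
Qed.

Lemma orthogonal_vector (d : nat) (v : 'I_d.+2 -> 'rV[R]_d.+1) (i l : 'I_d.+2) :
  i != l -> exists2 c, c != 0 & forall j, j != i -> j != l -> dot c (v j) = 0.
Proof.
move=> il; pose J := [pred j : 'I_d.+2 | (j != i) && (j != l)].
have cJ : #|J| = d.
  have := cardC (pred2 i l); rewrite card2 il card_ord => /eqP.
  have -> : #|predC (pred2 i l)| = #|J|.
    by apply: eq_card => j; rewrite !inE negb_or.
  by rewrite add2n !eqSS => /eqP.
(* The [d + 1] coordinate rows of the [d] remaining vectors are dependent, and the dependence is the
   normal vector sought. *)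
have [|a av [k ak]] := @linear_dependence R #|J| 'I_d.+1
    (fun k => \row_(m < #|J|) v (enum_val m) 0 k).
  by rewrite card_ord cJ.
exists (\row_k a k).
  by apply: contraNneq ak => /rowP/(_ k); rewrite !mxE => ->.
move=> j ji jl; have jJ : j \in J by rewrite inE ji jl.
have /rowP/(_ (enum_rank_in jJ j)) := av.
rewrite summxE mxE => h; rewrite -[RHS]h; apply: eq_bigr => m _.
by rewrite !mxE enum_rankK_in.
Qed.

Definition independent_transversals (d : nat) (K : finType)
    (p : 'I_d.+1 -> K -> 'rV[R]_d) :=
  forall (f : 'I_d.+1 -> K) (i : 'I_d.+1) (a : 'I_d.+1 -> R),
    a i = 0 -> \sum_j a j *: p j (f j) = 0 -> forall j, a j = 0.

(* With an extra vector [- u] in general position, the parity of [hit] for a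
   transversal is the sum over the colours [i] of terms that do not depend on
   the point of colour [i]. *)
Lemma octahedral_hits (d : nat) (K : finType) (k0 : K)
    (p : 'I_d.+2 -> K -> 'rV[R]_d.+1) :
  independent_transversals p ->
  octahedral d.+2 (fun s : seq K => `[< hit (fun i : 'I_d.+2 => p i (nth k0 s i)) >]).
Proof.
move=> ip.
(* [u] avoids, for each transversal and each pair of its points, a hyperplane through the origin and
   all the other points. *)
have [u hu] : exists u, forall (f : {ffun 'I_d.+2 -> K}) (i l : 'I_d.+2),
    i != l -> exists2 c, dot c u != 0 &
      forall j, j != i -> j != l -> dot c (p j (f j)) = 0.
  have /choice[c hc] : forall x : {ffun 'I_d.+2 -> K} * 'I_d.+2 * 'I_d.+2,
      exists c, c != 0 /\ (x.1.2 != x.2 ->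
      forall j, j != x.1.2 -> j != x.2 -> dot c (p j (x.1.1 j)) = 0).
    move=> [[f i] l] /=; have [il|il] := boolP (i != l).
      have [c c0 hc] := orthogonal_vector (fun j => p j (f j)) il.
      by exists c; split => // _.
    exists (const_mx 1); split=> //.
    by apply/eqP => /rowP/(_ 0); rewrite !mxE => /eqP; rewrite oner_eq0.
  have [u hu] := generic_vector (fun x => (proj1 (hc x))).
  exists u => f i l il; exists (c (f, i, l)); first exact: hu.
  exact: (proj2 (hc (f, i, l))).
pose w (s : seq K) (i : 'I_d.+3) :=
  if unlift ord0 i is Some j then p j (nth k0 s j) else - u.
have w_lift s j : w s (lift ord0 j) = p j (nth k0 s j) by rewrite /w liftK.
have w0 s : w s ord0 = - u by rewrite /w unlift_none.
have sumw s a : \sum_i a i *: w s i =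
    - (a ord0 *: u) + \sum_j a (lift ord0 j) *: p j (nth k0 s j).
  rewrite big_ord_recl w0 scalerN; congr (_ + _).
  by apply: eq_bigr => j _; rewrite w_lift.
have gw s : general_position (w s).
  have key (a : 'I_d.+3 -> R) j : a ord0 = 0 -> a (lift ord0 j) = 0 ->
      \sum_i a i *: w s i = 0 -> forall i, a i = 0.
    rewrite sumw => a0 aj; rewrite a0 scale0r oppr0 add0r => h i.
    have := ip (fun j => nth k0 s j) j _ aj h.
    by case: (unliftP ord0 i) => [m ->|->].
  move=> k l a kl ak al aw.
  case: (unliftP ord0 k) ak kl => [k' ->|->] ak kl; last first.
    case: (unliftP ord0 l) al kl => [l' ->|->] al; last by rewrite eqxx.
    by move=> _; apply: (key _ _ ak al aw).
  case: (unliftP ord0 l) al kl => [l' ->|->] al kl; last first.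
    exact: (key _ _ al ak aw).
  have kl' : k' != l' by apply: contraNneq kl => ->.
  have [c cu hc] := hu [ffun j : 'I_d.+2 => nth k0 s j] _ _ kl'.
  have a0 : a ord0 = 0.
    have := congr1 (dot c) aw; rewrite sumw dot0r dotDr dot_combr.
    rewrite -scaleNr dotZr big1 ?addr0 => [/eqP|j _].
      by rewrite mulf_eq0 (negbTE cu) orbF oppr_eq0 => /eqP.
    have [->|jk] := eqVneq j k'; first by rewrite ak mul0r.
    have [->|jl] := eqVneq j l'; first by rewrite al mul0r.
    by have := hc j jk jl; rewrite ffunE => ->; rewrite mulr0.
  exact: (key _ _ a0 ak aw).
rewrite (@eq_octahedral _ _ _ (fun s => \big[addb/false]_(i <- index_enum 'I_d.+2)
    `[< hit_avoiding (w s) (lift ord0 i) >])).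
  apply: octahedral_big => i; apply: (@octahedral_indep _ _ i k0) => // s t sk tk hst.
  have imp s' t' : (forall m, (m < d.+2)%N -> m != i -> nth k0 s' m = nth k0 t' m) ->
      hit_avoiding (w s') (lift ord0 i) -> hit_avoiding (w t') (lift ord0 i).
    move=> hst' [a [a0 a1 ai aw]]; exists a; split=> //.
    rewrite -[RHS]aw !sumw; congr (_ + _); apply: eq_bigr => j _.
    have [->|ji] := eqVneq j i; first by rewrite ai !scale0r.
    by rewrite hst'.
  by apply/asbool_equiv_eq; split; apply: imp => // m mk mi; rewrite hst.
move=> s sk; have := @even_hits _ _ (w s); rewrite card_ord => /(_ erefl (gw s)).
have addb_eq0 (a b : bool) : a (+) b = false -> a = b by case: a; case: b.
rewrite big_ord_recl => /addb_eq0.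
have -> : `[< hit_avoiding (w s) ord0 >] =
          `[< hit (fun i : 'I_d.+2 => p i (nth k0 s i)) >].
  apply/asbool_equiv_eq; split=> [[a [a0 [m am] a00 aw]]|[a [a0 a1] av]].
    apply: (@hit_pos _ _ _ _ (fun j => a (lift ord0 j))) => //.
      by case: (unliftP ord0 m) am => [j ->|->]; [exists j|rewrite a00 ltxx].
    by rewrite -[RHS]aw sumw a00 scale0r oppr0 add0r.
  pose b i := if unlift (ord0 : 'I_d.+3) i is Some j then a j else 0.
  have bl j : b (lift ord0 j) = a j by rewrite /b liftK.
  have b0 : b ord0 = 0 by rewrite /b unlift_none.
  exists b; split=> //.
  - by move=> i; rewrite /b; case: unlift.
  - by have [j aj] := weights_pos (conj a0 a1); exists (lift ord0 j); rewrite bl.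
  rewrite sumw b0 scale0r oppr0 add0r -[RHS]av.
  by apply: eq_bigr => j _; rewrite bl.
by [].
Qed.

End Parity.

(** * Perturbation to general position *)

Section Perturbation.
Variable R : realType.

Lemma eventually_forall (I : finType) (P : I -> R -> Prop) :
  (forall i, exists B, forall x, B <= x -> P i x) ->
  exists B, forall i x, B <= x -> P i x.
Proof.
move=> /choice[B hB]; exists (\sum_i `|B i|) => i x hx; apply: hB.
apply: le_trans (ler_norm _) (le_trans _ hx).
by rewrite (bigD1 i) //= lerDl sumr_ge0.
Qed.

Lemma det_neq0P (n : nat) (v : 'I_n -> 'rV[R]_n) :
  \det (\matrix_i v i) != 0 <->
  forall a : 'I_n -> R, \sum_i a i *: v i = 0 -> forall i, a i = 0.
Proof.
have mulE u : u *m (\matrix_i v i) = \sum_i u 0 i *: v i.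
  by rewrite mulmx_sum_row; apply: eq_bigr => i _; rewrite rowK.
split=> [/det0P nd a av i|h].
  apply/eqP/negPn/negP => ai; apply: nd; exists (\row_i a i).
    by apply: contraNneq ai => /rowP/(_ i); rewrite !mxE => ->.
  by rewrite mulE -[RHS]av; apply: eq_bigr => j _; rewrite mxE.
apply/det0P => -[u /eqP u0 uv]; apply: u0; apply/rowP => i; rewrite mxE.
by apply: (h (fun i => u 0 i)); rewrite -mulE.
Qed.

(** Determinants turn independence into finitely many polynomial conditions, suited to a
    one-parameter perturbation. *)
Lemma independent_transversalsP (d : nat) (K : finType)
    (p : 'I_d.+1 -> K -> 'rV[R]_d) :
  independent_transversals p <-> forall (f : {ffun 'I_d.+1 -> K}) i,
    \det (\matrix_j p (lift i j) (f (lift i j))) != 0.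
Proof.
split=> [ip f i|h f i a ai].
  apply/det_neq0P => a av j.
  pose b m := if unlift i m is Some j then a j else 0.
  have bl m : b (lift i m) = a m by rewrite /b liftK.
  rewrite -bl; apply: (ip f i b); first by rewrite /b unlift_none.
  rewrite (bigD1_ord i) //= {1}/b unlift_none scale0r add0r -[RHS]av.
  by apply: eq_bigr => m _; rewrite bl.
rewrite (bigD1_ord i) //= ai scale0r add0r => av j.
have := h [ffun j => f j] i => /det_neq0P/(_ (fun j => a (lift i j))) H.
case: (unliftP i j) => [m ->|->//]; apply: H.
by rewrite -[RHS]av; apply: eq_bigr => l _; rewrite ffunE.
Qed.

Lemma exists_centred_independent (d : nat) :
  exists r : 'I_d.+2 -> 'I_d.+2 -> 'rV[R]_d.+1,
    independent_transversals r /\ forall i, \sum_k r i k = 0.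
Proof.
(* The points of a colour are nonzero multiples, with sum 0, of one vector [g i]; the [g i] are the
   unit vectors and the all-ones vector, any [d + 1] of which are independent. *)
pose c (k : 'I_d.+2) : R := if k == ord_max then - d.+1%:R else 1.
pose g (i : 'I_d.+2) : 'rV[R]_d.+1 :=
  if unlift ord_max i is Some j then delta_mx 0 j else const_mx 1.
have c0 k : c k != 0.
  by rewrite /c; case: ifP => _; rewrite ?oppr_eq0 ?pnatr_eq0 ?oner_eq0.
exists (fun i k => c k *: g i); split=> [f i a ai|i]; last first.
  rewrite -scaler_suml big_ord_recr /= /c eqxx.
  rewrite (eq_bigr (fun=> 1)) => [|k _]; last first.
    by rewrite -val_eqE /= ltn_eqF.
  by rewrite sumr_const card_ord subrr scale0r.
pose b j := a j * c (f j).
have -> : \sum_j a j *: (c (f j) *: g j) = \sum_j b j *: g j.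
  by apply: eq_bigr => j _; rewrite scalerA.
move=> bg; have bcoord m : b ord_max + b (lift ord_max m) = 0.
  have /rowP/(_ m) := bg; rewrite summxE [RHS]mxE => h; rewrite -[RHS]h.
  rewrite (bigD1_ord ord_max) //= !mxE /g unlift_none mxE mulr1; congr (_ + _).
  rewrite (bigD1 m) //= big1 => [|l lm]; rewrite liftK !mxE ?eqxx ?mulr1 ?addr0 //.
  by rewrite eq_sym (negbTE lm) mulr0.
have bi : b i = 0 by rewrite /b ai mul0r.
have bmax : b ord_max = 0.
  by case: (unliftP ord_max i) bi => [m ->|->//] bm; rewrite -(bcoord m) bm addr0.
have b0 j : b j = 0.
  by case: (unliftP ord_max j) => [m ->|->//]; rewrite -(bcoord m) bmax add0r.
by move=> j; have /eqP := b0 j; rewrite mulf_eq0 (negbTE (c0 _)) orbF => /eqP.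
Qed.

Lemma quadratic_eventually_gt0 (A B C N : R) : 0 < A -> 0 <= N ->
  exists x0, forall x, x0 <= x -> 0 < (x + N) * (x * A + B) - x * C.
Proof.
move=> A0 N0; exists (1 + (N * `|B| + `|B| + `|C|) / A) => x hx.
have D0 : 0 <= (N * `|B| + `|B| + `|C|) / A.
  by rewrite divr_ge0 ?(ltW A0) // !addr_ge0 // mulr_ge0.
have x1 : 1 <= x by apply: le_trans hx; rewrite lerDl.
have xA : A + (N * `|B| + `|B| + `|C|) <= x * A.
  move: hx; rewrite -(ler_pM2r A0) mulrDl mul1r divfK //.
  by rewrite gt_eqF.
have hB : - `|B| <= B by rewrite lerNnormlW.
have hC : C <= `|C| by rewrite ler_norm.
have B0 : 0 <= `|B| by [].
have C0 : 0 <= `|C| by [].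
have NB : 0 <= N * `|B| by rewrite mulr_ge0.
have h1 : x * (A + (N * `|B| + `|B| + `|C|)) <= x * (x * A).
  by rewrite ler_wpM2l //; lra.
have h2 : x * (- `|B|) <= x * B by rewrite ler_wpM2l //; lra.
have h3 : x * C <= x * `|C| by rewrite ler_wpM2l //; lra.
have h4 : N * (- `|B|) <= N * B by rewrite ler_wpM2l.
have h5 : 0 <= N * (x * A) by rewrite mulr_ge0 // mulr_ge0 //; lra.
have h6 : N * `|B| <= x * (N * `|B|) by rewrite ler_peMl.
have h7 : 0 < x * A by rewrite mulr_gt0 //; lra.
nra.
Qed.

(* The points [(x + N) (x p_k + r_k) - x m], with [N] points per colour, have
   the relation [\sum_k (x w_k + 1) p'_k = 0]. They are multiples of [r_k] at
   [x = 0] and approach the rays through [p_k] as [x] tends to infinity. *)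
Lemma generic_perturbation (d : nat) (p : 'I_d.+2 -> 'I_d.+2 -> 'rV[R]_d.+1) :
  (forall i, hit (p i)) ->
  exists p' : 'I_d.+2 -> 'I_d.+2 -> 'rV[R]_d.+1,
    [/\ independent_transversals p', forall i, hit (p' i) &
        forall f : 'I_d.+2 -> 'I_d.+2,
          hit (fun i => p' i (f i)) -> hit (fun i => p i (f i))].
Proof.
move=> hp; have [r [ir sr]] := exists_centred_independent d.
have /choice[w hw] : forall i, exists w : 'I_d.+2 -> R,
    weights w /\ \sum_k w k *: p i k = 0.
  by move=> i; have [w ww wp] := hp i; exists w.
have [N NE] : exists N : R, N = d.+2%:R by exists d.+2%:R.
have N_gt0 : 0 < N by rewrite NE ltr0n.
(* Since the [w]-combination of the [p] and the sum of the [r] vanish, the weights [x * w i k + 1]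
   send [x *: p i k + r i k] to [x *: m i]; subtracting [x *: m i] restores the origin. *)
pose m i := \sum_k (w i k *: r i k + p i k).
pose p' x i k := (x + N) *: (x *: p i k + r i k) - x *: m i.
have hit_p' x i : 0 <= x -> hit (p' x i).
  move=> x0; have [[w0 w1] wp] := hw i.
  apply: (@hit_pos _ _ _ _ (fun k => x * w i k + 1)).
  - by move=> k; rewrite addr_ge0 ?mulr_ge0.
  - by exists ord0; rewrite ltr_wpDl ?mulr_ge0.
  under eq_bigr do rewrite /p' scalerBr scalerA mulrC -scalerA.
  rewrite sumrB -scaler_suml -scaler_sumr.
  have -> : \sum_k (x * w i k + 1) = x + N.
    rewrite big_split /= -big_distrr /= w1 mulr1.
    by rewrite sumr_const card_ord NE.
  have -> : \sum_k (x * w i k + 1) *: (x *: p i k + r i k) = x *: m i.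
    rewrite (eq_bigr (fun k => (x * x) *: (w i k *: p i k) + r i k +
      x *: (w i k *: r i k + p i k))).
      by rewrite !big_split /= -!scaler_sumr wp sr scaler0 !add0r.
    move=> k _; apply/rowP => j; rewrite !mxE; ring.
  by rewrite subrr.
have [B1 hB1] : exists B, forall (fi : {ffun 'I_d.+2 -> 'I_d.+2} * 'I_d.+2) x, B <= x ->
    \det (\matrix_j p' x (lift fi.2 j) (fi.1 (lift fi.2 j))) != 0.
  apply: eventually_forall => -[f i] /=.
  (* The determinant is a polynomial in [x], nonzero at [x = 0] by independence of the [r], hence
     nonzero beyond its Cauchy bound. *)
  pose M : 'M[{poly R}]_d.+1 := \matrix_(j, l)
    (('X + N%:P) * ('X * (p (lift i j) (f (lift i j)) 0 l)%:P +
       (r (lift i j) (f (lift i j)) 0 l)%:P) - 'X * (m (lift i j) 0 l)%:P).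
  have ME x : (\det M).[x] = \det (\matrix_j p' x (lift i j) (f (lift i j))).
    rewrite -[LHS]/(horner_eval x (\det M)) -det_map_mx; congr (\det _).
    by apply/matrixP => j l; rewrite !mxE /= /horner_eval !hornerE.
  have Q0 : \det M != 0.
    apply/eqP => /(congr1 (fun q => q.[0])); rewrite ME horner0 => /eqP.
    apply/negP; have -> : (\matrix_j p' 0 (lift i j) (f (lift i j))) =
        N *: (\matrix_j r (lift i j) (f (lift i j))).
      by apply/matrixP => j l; rewrite !mxE; ring.
    rewrite detZ mulf_neq0 ?expf_neq0 ?(gt_eqF N_gt0) //.
    exact: (proj1 (independent_transversalsP r) ir f i).
  exists (cauchy_bound (\det M)) => x hx; rewrite -ME.
  apply/eqP => /(cauchy_boundP Q0); rewrite ltNge => /negP; apply.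
  exact: le_trans hx (ler_norm _).
have [B2 hB2] : exists B, forall (f : {ffun 'I_d.+2 -> 'I_d.+2}) x, B <= x ->
    hit (fun i => p' x i (f i)) -> hit (fun i => p i (f i)).
  apply: eventually_forall => f.
  have [hf|nhf] := pselect (hit (fun i => p i (f i))); first by exists 0.
  (* A strict separation of the transversal from the origin survives for large [x], because the
     leading coefficient of [dot c (p' x i (f i))] is [dot c (p i (f i))]. *)
  have [c hc] := gordan nhf.
  have [B hB] : exists B, forall i x, B <= x -> 0 < dot c (p' x i (f i)).
    apply: eventually_forall => i.
    have [B hB] := quadratic_eventually_gt0 (dot c (r i (f i))) (dot c (m i))
                     (hc i) (ltW N_gt0).
    by exists B => x /hB; rewrite /p' dotBr !dotZr dotDr dotZr.
  exists B => x /hB px [a wa av]; exfalso.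
  have [j aj] := weights_pos wa.
  have /eqP : a j * dot c (p' x j (f j)) = 0.
    apply: (@nonneg_sum_eq0 _ _ (fun j => a j * dot c (p' x j (f j)))).
      by move=> i; rewrite mulr_ge0 ?(proj1 wa) // ltW.
    by rewrite -dot_combr av dot0r.
  by rewrite mulf_eq0 !gt_eqF.
pose x := `|B1| + `|B2|.
have x1 : B1 <= x by rewrite /x (le_trans (ler_norm _)) // lerDl.
have x2 : B2 <= x by rewrite /x (le_trans (ler_norm _)) // lerDr.
exists (p' x); split.
- by apply/independent_transversalsP => f i; exact: (hB1 (f, i)).
- by move=> i; apply: hit_p'; rewrite addr_ge0.
move=> f [a wa av]; have [|b wb bv] := hB2 [ffun i => f i] x x2.
  by exists a => //; rewrite -[RHS]av; apply: eq_bigr => i _; rewrite ffunE.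
by exists b => //; rewrite -[RHS]bv; apply: eq_bigr => i _; rewrite ffunE.
Qed.

End Perturbation.

(** * Counting colourful simplices *)

Section Words.
Variable T : finType.

Fixpoint words k : seq (seq T) :=
  if k is k'.+1 then [seq x :: s | x <- enum T, s <- words k'] else [:: [::]].

Lemma words_uniq k : uniq (words k).
Proof.
elim: k => [//|k IH]; apply: allpairs_uniq => //; first exact: enum_uniq.
by move=> [x s] [y t] _ _ [-> ->].
Qed.

Lemma mem_words k s : (s \in words k) = (size s == k).
Proof.
elim: k s => [|k IH] [|x s] //=.
  by apply/negbTE/allpairsPdep => -[y [t []]].
rewrite eqSS -IH; apply/allpairsPdep/idP => [[y [t [_ ht [_ ->]]]] //|hs].
by exists x, s; rewrite mem_enum.
Qed.

Lemma num_edges_words k (E : seq T -> bool) : num_edges k E = count E (words k).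
Proof.
elim: k E => [|k IH] E /=; first by rewrite addn0.
rewrite count_flatten -map_comp sumnE big_map big_enum /=.
by apply: eq_bigr => x _; rewrite IH /= count_map.
Qed.

Lemma num_edges_gt0 k (E : seq T -> bool) s :
  size s = k -> E s -> (0 < num_edges k E)%N.
Proof.
move=> sk Es; rewrite num_edges_words -has_count; apply/hasP; exists s => //.
by rewrite mem_words sk.
Qed.

End Words.

Section Transversals.
Variable R : realType.

Definition enumerates (V : choiceType) (I : finType) (A : {fset V}) (h : I -> V) :=
  injective h /\ forall x, (x \in A) = (x \in codom h).

Lemma enumerates_perm (V : choiceType) (I : finType) (A : {fset V}) (h : I -> V) :
  enumerates A h -> perm_eq A (map h (enum I)).
Proof.
move=> [hi hA]; apply: uniq_perm; first exact: fset_uniq.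
  by rewrite map_inj_uniq // enum_uniq.
by move=> x; rewrite hA.
Qed.

Lemma enumerates_card (V : choiceType) (I : finType) (A : {fset V}) (h : I -> V) :
  enumerates A h -> #|` A| = #|I|.
Proof. by move=> hA; rewrite (perm_size (enumerates_perm hA)) size_map -cardE. Qed.

Lemma enumerates_sum (V W : zmodType) (I : finType) (A : {fset V}) (h : I -> V)
    (F : V -> W) : enumerates A h -> \sum_(x <- A) F x = \sum_i F (h i).
Proof. by move=> hA; rewrite (perm_big _ (enumerates_perm hA)) big_map big_enum. Qed.

Lemma conv_hit (d : nat) (I : finType) (A : {fset 'rV[R]_d}) (h : I -> 'rV[R]_d) :
  enumerates A h -> conv A 0 <-> hit h.
Proof.
move=> hA; have [hi Ah] := hA; split=> [[w [w0 w1 wA]]|[a [a0 a1] ah]].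
  exists (fun i => w (h i)); first split.
  - by move=> i; apply: w0; rewrite Ah codom_f.
  - by rewrite -(enumerates_sum _ hA).
  by rewrite [RHS]wA (enumerates_sum _ hA).
pose w x := \sum_(i | h i == x) a i.
have wh i : w (h i) = a i by rewrite /w (big_pred1 i) // => j; rewrite /= (inj_eq hi).
exists w; split.
- by move=> x _; apply: sumr_ge0.
- by rewrite (enumerates_sum _ hA) -[RHS]a1; apply: eq_bigr => i _.
by rewrite (enumerates_sum _ hA) -[LHS]ah; apply: eq_bigr => i _; rewrite wh.
Qed.

Lemma enumerates_nth (V : zmodType) n (A : {fset V}) :
  #|` A| = n -> enumerates A (fun k : 'I_n => nth 0 A k).
Proof.
move=> cA; split=> [k l /eqP|x].
  by rewrite nth_uniq ?fset_uniq // ?[X in (_ < X)%N]cA // => /eqP/val_inj.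
apply/idP/codomP => [xA|[k ->]]; last by apply: mem_nth; rewrite [X in (_ < X)%N]cA.
have ix : (index x A < n)%N by rewrite -cA index_mem.
by exists (Ordinal ix); rewrite nth_index.
Qed.

Variables (d : nat) (K : finType) (S : 'I_d.+1 -> {fset 'rV[R]_d}).
Variable p : 'I_d.+1 -> K -> 'rV[R]_d.
Hypothesis disjS : colourful_configuration S.
Hypothesis Sp : forall i, enumerates (S i) (p i).

Lemma mem_colour i k : p i k \in S i.
Proof. by rewrite (proj2 (Sp i)) codom_f. Qed.

Lemma colour_inj i j k l : p i k = p j l -> i = j /\ k = l.
Proof.
move=> e; have ij : i = j.
  apply/eqP/negPn/negP => /disjS/fdisjointP/(_ _ (mem_colour i k)).
  by rewrite e mem_colour.
by split=> //; move: e; rewrite ij => /(proj1 (Sp j)).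
Qed.

Definition transversal (f : 'I_d.+1 -> K) : {fset 'rV[R]_d} :=
  [fset p i (f i) | i in 'I_d.+1]%fset.

Lemma transversalP f x :
  reflect (exists i, x = p i (f i)) (x \in transversal f).
Proof.
apply: (iffP (imfsetP _ _ _ _)) => [[i _ ->]|[i ->]]; first by exists i.
by exists i.
Qed.

Lemma enumerates_transversal f : enumerates (transversal f) (fun i => p i (f i)).
Proof.
split=> [i j /colour_inj[]//|x].
by apply/transversalP/codomP.
Qed.

Lemma transversal_inj f g : transversal f = transversal g -> f =1 g.
Proof.
move=> e i; have : p i (f i) \in transversal g.
  by rewrite -e; apply/transversalP; exists i.
by move=> /transversalP[j /colour_inj[<-]].
Qed.

Lemma colourful_transversal f : colourful_simplex S (transversal f).
Proof.
split=> [|i].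
  apply/fsubsetP => x /transversalP[i ->]; apply/bigfcupP.
  by exists i; rewrite ?mem_enum ?mem_colour.
apply/eqP/cardfs1P; exists (p i (f i)); apply/fsetP => x; rewrite !inE.
apply/andP/eqP => [[/transversalP[j ->]]|->].
  by rewrite (proj2 (Sp i)) => /codomP[k /colour_inj[-> _]].
by split; [apply/transversalP; exists i|exact: mem_colour].
Qed.

Lemma colourful_simplexP T :
  colourful_simplex S T -> exists f, T = transversal f.
Proof.
move=> [TS T1].
have /choice[f hf] : forall i, exists k, (T `&` S i)%fset = [fset p i k]%fset.
  move=> i; have /eqP/cardfs1P[x ex] := T1 i.
  have : x \in (T `&` S i)%fset by rewrite ex inE.
  rewrite inE => /andP[_]; rewrite (proj2 (Sp i)) => /codomP[k xk].
  by exists k; rewrite ex xk.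
exists f; apply/fsetP => x; apply/idP/transversalP => [xT|[i ->]].
  have /fsubsetP/(_ _ xT)/bigfcupP[i _ xS] := TS.
  have : x \in (T `&` S i)%fset by rewrite inE xT.
  by rewrite hf inE => /eqP ->; exists i.
have : p i (f i) \in (T `&` S i)%fset by rewrite hf inE.
by rewrite inE => /andP[].
Qed.

Definition hit_simplices :=
  [fset T in fpowerset (\bigcup_(i <- enum 'I_d.+1) S i)%fset
        | `[< colourful_simplex S T /\ conv T 0 >]]%fset.

Lemma transversal_hit f : hit (fun i => p i (f i)) ->
  transversal f \in hit_simplices.
Proof.
move=> hf; rewrite !inE /=; apply/andP; split.
  by rewrite fpowersetE; exact: (proj1 (colourful_transversal f)).
apply/asboolP; split; first exact: colourful_transversal.
by apply/(conv_hit (enumerates_transversal f)).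
Qed.

Lemma hit_simplex_transversal T : T \in hit_simplices ->
  exists2 f, T = transversal f & hit (fun i => p i (f i)).
Proof.
rewrite !inE /= => /andP[_ /asboolP[/colourful_simplexP[f ->] hf]].
by exists f => //; apply/(conv_hit (enumerates_transversal f)).
Qed.

(** The colours are disjoint, so distinct words give distinct simplices. *)
Lemma num_edges_le_simplices (k0 : K) (E : seq K -> bool) :
  (forall s, E s -> hit (fun i => p i (nth k0 s i))) ->
  (num_edges d.+1 E <= num_simplices_containing0 S)%N.
Proof.
move=> hE; rewrite num_edges_words -size_filter.
rewrite -(size_map (fun s => transversal (fun i => nth k0 s i))).
apply: uniq_leq_size.
  rewrite map_inj_in_uniq ?filter_uniq ?words_uniq // => s t.
  rewrite !mem_filter !mem_words => /andP[_ /eqP sk] /andP[_ /eqP tk].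
  move=> /transversal_inj e; apply: (@eq_from_nth _ k0); rewrite ?sk ?tk // => i ik.
  by have := e (Ordinal ik).
move=> T /mapP[s]; rewrite mem_filter => /andP[/hE hs _] ->.
exact: transversal_hit.
Qed.

End Transversals.

(** * Lower bound for the number of simplices containing the origin *)

Section LowerBound.
Variable R : realType.

Lemma simplices_lower_bound (d : nat) (S : 'I_d.+2 -> {fset 'rV[R]_d.+1}) :
  colourful_configuration S -> (forall i, #|` S i| = d.+2) ->
  (forall i, conv (S i) 0) ->
  (d.+1 ^ 2 + 1 <= num_simplices_containing0 S)%N.
Proof.
move=> disjS cS S0.
pose p i (k : 'I_d.+2) := nth 0 (S i) k.
have Sp i : enumerates (S i) (p i) by exact: enumerates_nth.
have hp i : hit (p i) by apply/(conv_hit (Sp i)).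
have [q [iq hq hqp]] := generic_perturbation hp.
pose E (s : seq 'I_d.+2) := `[< hit (fun i : 'I_d.+2 => q i (nth ord0 s i)) >].
have oE : octahedral d.+2 E by exact: octahedral_hits.
have le : (num_edges d.+2 E <= num_simplices_containing0 S)%N.
  apply: (num_edges_le_simplices disjS Sp (k0 := ord0)) => s /asboolP hs.
  exact: (hqp (fun i => nth ord0 s i)).
(* Colourful Caratheodory with a prescribed point makes [E] nonempty and all its links nonempty. *)
have edge (i k : 'I_d.+2) : exists s, [/\ size s = d.+2, E s & nth ord0 s i = k].
  have [f fi hf] := colourful_caratheodory i k hq.
  exists [seq f j | j <- enum 'I_d.+2].
  have nthE (j : 'I_d.+2) : nth ord0 [seq f j | j <- enum 'I_d.+2] j = f j.
    by rewrite (nth_map ord0) ?size_enum_ord // nth_ord_enum.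
  split; [by rewrite size_map size_enum_ord| |by rewrite nthE].
  apply/asboolP; have [a wa av] := hf; exists a => //.
  by rewrite -[RHS]av; apply: eq_bigr => j _; rewrite nthE.
apply: leq_trans le.
have := @octahedral_system_bound 'I_d.+2 d.+1 E; rewrite card_ord.
have [s [sd Es _]] := edge ord0 ord0.
move=> /(_ isT oE (num_edges_gt0 sd Es)) bound.
(* With [d + 2] points in each of [d + 2] colours, [2 + d (d + 2)] equals [(d + 1) ^ 2 + 1], and
   [(d + 2) ^ 2] is larger. *)
apply: leq_trans (bound _); first by rewrite leq_min; apply/andP; split; nia.
move=> j y jd; have jd' : (j < d.+2)%N by [].
have [t [td Et ty]] := edge (Ordinal jd') y.
apply: (@num_edges_gt0 _ _ _ (take j t ++ drop j.+1 t)).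
  by rewrite size_cat size_takel ?td ?size_drop ?td; lia.
rewrite /link_at take_size_cat ?size_takel ?td //; last lia.
rewrite drop_size_cat ?size_takel ?td //; last lia.
by move: Et; rewrite -{1}(cat_take_drop j t) (drop_nth ord0) ?td // ty.
Qed.

End LowerBound.

(** * A configuration with few simplices *)

Section ExtremalConfiguration.
Variables (R : realType) (d : nat).
Local Notation n := d.+2.

(* With [n = d + 2], the colour [0] consists of [- n (1, ..., 1)] and of the
   points [n (n e_j - (1, ..., 1))]; the colour [j + 1] consists of the points
   [e_j, - e_j, - 2 e_j, ..., - (d + 1) e_j]. *)
Definition centre_coef (k : 'I_n) (m : 'I_d.+1) : R :=
  n%:R * (n%:R * (k == lift ord0 m)%:R - 1).

Definition axis_coef (k : 'I_n) : R := if k == ord0 then 1 else - (k : nat)%:R.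

Definition extremal_point (i k : 'I_n) : 'rV[R]_d.+1 :=
  if unlift ord0 i is Some j then axis_coef k *: delta_mx 0 j
  else \row_m centre_coef k m.

Lemma extremal_point0 k m : extremal_point ord0 k 0 m = centre_coef k m.
Proof. by rewrite /extremal_point unlift_none mxE. Qed.

Lemma extremal_point_lift j k m :
  extremal_point (lift ord0 j) k 0 m = axis_coef k * (m == j)%:R.
Proof. by rewrite /extremal_point liftK !mxE. Qed.

Lemma axis_coef_lift m : axis_coef (lift ord0 m) = - m.+1%:R.
Proof. by rewrite /axis_coef. Qed.

Lemma axis_coef_neq0 k : axis_coef k != 0.
Proof.
case: (unliftP ord0 k) => [m ->|->]; first by rewrite axis_coef_lift oppr_eq0 pnatr_eq0.
by rewrite /axis_coef eqxx oner_eq0.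
Qed.

Lemma axis_coef_gt0 k : (0 < axis_coef k) = (k == ord0).
Proof.
rewrite /axis_coef; case: ifP => _; first exact: ltr01.
by rewrite oppr_gt0 ltrn0.
Qed.

Lemma axis_coef_inj : injective axis_coef.
Proof.
move=> k l; case: (unliftP ord0 k) => [k' ->|->]; case: (unliftP ord0 l) => [l' ->|->] //.
- rewrite !axis_coef_lift => /oppr_inj /eqP; rewrite eqr_nat eqSS => /eqP.
  by move/val_inj ->.
- by move=> e; have := axis_coef_gt0 (lift ord0 k'); rewrite e axis_coef_gt0 eqxx.
- by move=> e; have := axis_coef_gt0 (lift ord0 l'); rewrite -e axis_coef_gt0 eqxx.
Qed.

Lemma centre_coef_gt0 k m : (0 < centre_coef k m) = (k == lift ord0 m).
Proof.
rewrite /centre_coef pmulr_rgt0 ?ltr0n //; case: eqP => _; last first.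
  by rewrite mulr0 sub0r oppr_gt0 ltr10.
by rewrite mulr1 subr_gt0 ltr1n.
Qed.

Lemma centre_coef_neq0 k m : centre_coef k m != 0.
Proof.
rewrite /centre_coef mulf_neq0 ?pnatr_eq0 //; case: (k == _); last first.
  by rewrite mulr0 sub0r oppr_eq0 oner_eq0.
by rewrite mulr1 subr_eq0 (eqr_nat R _ 1).
Qed.

(** The scaling by [n] gives colour [0] the coordinates [- n] and [n (n - 1)], outside the range
    from [- (n - 1)] to 1 of [axis_coef]; this separates it from the other colours. *)
Lemma centre_axis_neq k l m : centre_coef k m != axis_coef l.
Proof.
rewrite /centre_coef; case: (k == _); last first.
  rewrite mulr0 sub0r mulrN1; case: (unliftP ord0 l) => [l' ->|->].
    rewrite axis_coef_lift eqr_opp eqr_nat eqSS eq_sym.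
    by rewrite ltn_eqF // ltn_ord.
  by rewrite /axis_coef eqxx; apply/eqP => e; have := ler0n R n; lra.
apply: contraTneq isT => e.
have : 2 <= axis_coef l.
  rewrite -e mulr1 -{1}[2]mulr1 ler_pM ?ler0n ?ler01 //.
    by rewrite ler_nat.
  by rewrite lerBrDr -(natrD R 1 1) ler_nat.
case: (unliftP ord0 l) => [l' ->|->].
  rewrite axis_coef_lift; have := ler0n R l'.+1; lra.
rewrite /axis_coef eqxx; lra.
Qed.

Lemma extremal_point_inj i j k l :
  extremal_point i k = extremal_point j l -> i = j /\ k = l.
Proof.
move=> /rowP e.
case: (unliftP ord0 i) e => [i' ->|->]; case: (unliftP ord0 j) => [j' ->|->] e.
- have := e i'; rewrite !extremal_point_lift eqxx mulr1.
  case: eqP => [->|_]; last by move/eqP; rewrite mulr0 (negbTE (axis_coef_neq0 _)).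
  by rewrite mulr1 => /axis_coef_inj ->.
- have := e i'; rewrite extremal_point_lift extremal_point0 eqxx mulr1 => /eqP.
  by rewrite eq_sym (negbTE (centre_axis_neq _ _ _)).
- have := e j'; rewrite extremal_point_lift extremal_point0 eqxx mulr1 => /eqP.
  by rewrite (negbTE (centre_axis_neq _ _ _)).
have kl m : (k == lift ord0 m) = (l == lift ord0 m).
  by have := e m; rewrite !extremal_point0 -!centre_coef_gt0 => ->.
split=> //; case: (unliftP ord0 k) kl => [k' ->|->] kl.
  by have := kl k'; rewrite eqxx => /esym/eqP.
case: (unliftP ord0 l) kl => [l' ->|->//] kl.
by have := kl l'; rewrite eqxx.
Qed.

Lemma extremal_point_hit i : hit (extremal_point i).
Proof.
case: (unliftP ord0 i) => [j ->|->].
  pose k1 : 'I_n := lift ord0 ord0.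
  apply: (@hit_pos _ _ _ _ (fun k => ((k == ord0) || (k == k1))%:R)).
  - by move=> k; rewrite ler0n.
  - by exists ord0; rewrite eqxx ltr01.
  rewrite (bigD1 ord0) //= (bigD1 k1) //= big1 ?addr0 => [|k /andP[k0 kk1]].
    apply/rowP => m; rewrite !mxE !extremal_point_lift axis_coef_lift.
    by rewrite /axis_coef eqxx /=; ring.
  by rewrite (negbTE k0) (negbTE kk1) scale0r.
apply: (@hit_pos _ _ _ _ (fun=> 1)) => [k||]; first exact: ler01.
  by exists ord0; exact: ltr01.
apply/rowP => m; rewrite summxE mxE.
rewrite (eq_bigr (fun k => n%:R * (n%:R * (k == lift ord0 m)%:R - 1))) => [|k _].
  rewrite -big_distrr /= sumrB -big_distrr /= (bigD1 (lift ord0 m)) //= eqxx.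
  rewrite big1 => [|k /negbTE -> //].
  by rewrite addr0 mulr1 sumr_const card_ord subrr mulr0.
by rewrite mxE extremal_point0 mul1r.
Qed.

(** Coordinate [j] of the relation involves only colour [0] and colour [j + 1], so their
    coefficients there have opposite signs. *)
Lemma extremal_hit_pattern (f : 'I_n -> 'I_n) :
  hit (fun i => extremal_point i (f i)) ->
  forall j, (f (lift ord0 j) == ord0) = (f ord0 != lift ord0 j).
Proof.
move=> [a [a0 a1] ah].
have coord j : a ord0 * centre_coef (f ord0) j +
    a (lift ord0 j) * axis_coef (f (lift ord0 j)) = 0.
  have /rowP/(_ j) := ah; rewrite summxE [RHS]mxE => h; rewrite -[RHS]h.
  rewrite (bigD1_ord ord0) //= mxE extremal_point0; congr (_ + _).
  rewrite (bigD1 j) //= mxE extremal_point_lift eqxx mulr1 big1 ?addr0 // => m mj.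
  by rewrite mxE extremal_point_lift eq_sym (negbTE mj) !mulr0.
(* Without colour [0], each coordinate would force the weight of its axis point to vanish. *)
have a0_gt0 : 0 < a ord0.
  rewrite lt_neqAle a0 andbT eq_sym; apply/eqP => e.
  have [i] := weights_pos (conj a0 a1).
  case: (unliftP ord0 i) => [j ->|->]; last by rewrite e ltxx.
  have /eqP := coord j; rewrite e mul0r add0r mulf_eq0.
  by rewrite (negbTE (axis_coef_neq0 _)) orbF => /eqP ->; rewrite ltxx.
move=> j; rewrite -axis_coef_gt0 -centre_coef_gt0.
have := coord j; have := a0 (lift ord0 j).
set b := a (lift ord0 j); set s := axis_coef _; set c := centre_coef _ _.
have s0 : s != 0 := axis_coef_neq0 _.
have c0 : c != 0 := centre_coef_neq0 _ _.
move=> b0 e.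
have [cpos|cneg] := ltrP 0 c.
  have ac : 0 < a ord0 * c by rewrite mulr_gt0.
  apply/negbTE; rewrite -leNgt leNgt; apply/negP => s_gt0.
  have : 0 <= b * s by rewrite mulr_ge0 // ltW.
  lra.
have c_lt0 : c < 0 by rewrite lt_neqAle c0.
have ac : a ord0 * c < 0 by rewrite pmulr_rlt0.
rewrite lt_neqAle eq_sym s0 /= leNgt; apply/negP => s_lt0.
have : b * s <= 0 by rewrite mulr_ge0_le0 // ltW.
lra.
Qed.

Definition extremal_colour (i : 'I_n) : {fset 'rV[R]_d.+1} :=
  [fset extremal_point i k | k in 'I_n]%fset.

Lemma enumerates_extremal i : enumerates (extremal_colour i) (extremal_point i).
Proof.
split=> [k l /extremal_point_inj[]//|x].
by apply/imfsetP/codomP => [[k _ ->]|[k ->]]; exists k.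
Qed.

Lemma extremal_disjoint : colourful_configuration extremal_colour.
Proof.
move=> i j ij; apply/fdisjointP => x /imfsetP[k _ ->]; apply/imfsetP => -[l _].
by move=> /extremal_point_inj[e]; move: ij; rewrite e eqxx.
Qed.

Lemma extremal_count :
  (num_simplices_containing0 extremal_colour <= d.+1 ^ 2 + 1)%N.
Proof.
(* If colour [0] contributes its point [ord0], all other choices are forced. If it contributes
   [lift ord0 j], only colour [j + 1] is free, among its [d + 1] negative points. *)
pose g (j m : 'I_d.+1) (i : 'I_n) : 'I_n :=
  if i == ord0 then lift ord0 j
  else if i == lift ord0 j then lift ord0 m else ord0.
pose L := transversal extremal_point (fun=> ord0) ::
  [seq transversal extremal_point (g j m) | j <- enum 'I_d.+1, m <- enum 'I_d.+1].
have -> : (d.+1 ^ 2 + 1 = size L)%N.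
  by rewrite /= size_allpairs size_enum_ord addn1 -mulnn.
apply: uniq_leq_size; first exact: fset_uniq.
move=> T /(hit_simplex_transversal extremal_disjoint enumerates_extremal).
move=> [f -> /extremal_hit_pattern hf].
rewrite inE; case: (unliftP ord0 (f ord0)) => [j fj|f0].
  apply/orP; right; apply/allpairsP.
  have : f (lift ord0 j) != ord0 by rewrite hf fj eqxx.
  case: (unliftP ord0 (f (lift ord0 j))) => [m fm _|->]; last by rewrite eqxx.
  exists (j, m); rewrite !mem_enum; split=> //=.
  congr transversal; apply/funext => i; rewrite /g.
  case: (unliftP ord0 i) => [l ->|->]; last by rewrite eqxx.
  rewrite eq_sym (negbTE (neq_lift _ _)); case: eqP => [->//|jl].
  apply/eqP; rewrite hf fj; apply/eqP => e; apply: jl; exact: esym.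
apply/orP; left; apply/eqP; congr transversal; apply/funext => i.
case: (unliftP ord0 i) => [l ->|->]; last exact: f0.
by apply/eqP; rewrite hf f0 neq_lift.
Qed.

End ExtremalConfiguration.

Theorem theorem1 (R : realType) (d : nat) (hd : (1 <= d)%N) :
  mu R d = (d ^ 2 + 1)%N.
Proof.
case: d hd => [//|d] _.
have lower n : attained_counts R d.+1 n -> (d.+1 ^ 2 + 1 <= n)%N.
  by move=> [S [disjS cS S0 ->]]; exact: simplices_lower_bound.
have attained : attained_counts R d.+1 (d.+1 ^ 2 + 1)%N.
  exists (@extremal_colour R d); have disjE := @extremal_disjoint R d.
  have card_E (i : 'I_d.+2) : #|` extremal_colour R i| = d.+2.
    by rewrite (enumerates_card (enumerates_extremal R i)) card_ord.
  have E0 (i : 'I_d.+2) : conv (extremal_colour R i) 0.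
    by apply/(conv_hit (enumerates_extremal R i)); exact: extremal_point_hit.
  (* The count was only bounded above; the lower bound applied to this very configuration gives
     equality. *)
  split=> //; apply/eqP; rewrite eqn_leq extremal_count andbT.
  exact: simplices_lower_bound.
apply: xget_unique => [//|m [am mmin]]; apply/eqP.
by rewrite eqn_leq mmin //= lower.
Qed.
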